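(* Consider the positivity-preserving DDFV scheme and its regularization $\mathcal{F}^{\epsilon,\eta}$ described in the context. Let $p^n=(p_g^n,p_w^n)\in\mathbb{R}^{\mathcal{T}_{Dir}}\times\mathbb{R}^{\mathcal{T}_{Dir}}$ be such that the associated saturations satisfy $0\le s^n_{\alpha,A}\le1$ for all $\alpha\in\{g,w\}$ and all cells $A$, and let $\delta t>0$. Then for every $\epsilon>0$ and $\eta>0$ the regularized scheme $\mathcal{F}^{\epsilon,\eta}(p,p^n)=0$ has a solution $p=(p_g,p_w)\in\mathbb{R}^{\mathcal{T}_{Dir}}\times\mathbb{R}^{\mathcal{T}_{Dir}}$. Consequently, the (non-regularized) positivity-preserving DDFV scheme $\mathcal{F}^{0,0}(p,p^n)=0$ has a solution $p=(p_g,p_w)\in\mathbb{R}^{\mathcal{T}_{Dir}}\times\mathbb{R}^{\mathcal{T}_{Dir}}$.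
   Context: **Data.** $\Omega\subset\mathbb{R}^2$ is a bounded open polygonal domain, with $\partial\Omega=\Gamma_{Dir}\cup\Gamma_N$ and $|\Gamma_{Dir}|>0$. The phases are $\alpha\in\{g,w\}$, with $|g|=0$, $|w|=1$. - The capillary pressure $p_c:\mathbb{R}\to\mathbb{R}$ is an increasing homeomorphism, piecewise $C^1$ with bounded derivative, $p_c(0)=0$. - Saturations are given by $s_g=p_c^{-1}(p_g-p_w)$, $s_w=1-s_g$. - The mobilities $M_\alpha:\mathbb R\to[0,\infty)$ are continuous, increasing on $[0,1]$, with $M_\alpha(u)=0$ for $u\le0$ and $M_\alpha(u)=M_\alpha(1)$ for $u\ge1$. There is $m_0>0$ with $M_w(1-u)+M_g(u)\ge m_0$ for all $u$. Set $M_\alpha^\epsilon=\epsilon+M_\alpha$. - Porosity: $\phi\in L^\infty(\Omega)$, $0<\phi_0\le\phi\le\phi_1$ a.e. - $\Lambda(x)$ is a symmetric matrix with $\underline\Lambda|v|^2\le\Lambda(x)v\cdot v\le\overline\Lambda|v|^2$ for all $v$ and a.e. $x$, with $0<\underline\Lambda\le\overline\Lambda$. - Densities: $\rho_\alpha\in C^1(\mathbb{R})$ is increasing with $0<\rho_0\le\rho_\alpha\le\rho_1$. There are no gravity or source terms, and the Dirichlet conditions are $p_g=p_w=0$ on $\Gamma_{Dir}$. **DDFV mesh.** The primal mesh $\mathfrak{M}$ is a finite set of disjoint open polygons $K$ covering $\Omega$, with centers $x_K$. $\partial\mathfrak{M}$ is the set of boundary edges, viewed as degenerate cells with centers $x_K$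 (the midpoints), and $\overline{\mathfrak M}=\mathfrak M\cup\partial\mathfrak M$. Two neighbouring cells $K,L\in\overline{\mathfrak M}$ share an edge $\sigma=K|L$ (when $L\in\partial\mathfrak M$, the edge is $L$ itself); $\mathcal{E}_K$ is the set of edges of $K$. Dual cells $K^*\in\overline{\mathfrak M^*}=\mathfrak M^*\cup\partial\mathfrak M^*$ correspond to the primal vertices $x_{K^*}$ (interior, respectively boundary vertices). $K^*$ is the polygon obtained by joining in circular order the centers of the primal cells sharing $x_{K^*}$; for a boundary vertex one also joins the midpoints of the two boundary edges at $x_{K^*}$ and the vertex $x_{K^*}$. To each primal edge $\sigma=K|L$ with endpoints $x_{K^*},x_{L^*}$ is associated the dual edge $\sigma^*=K^*|L^*=[x_K,x_L]$ and the diamond $\mathcal{D}$ with vertices $x_K,x_{K^*},x_L,x_{L^*}$. $\mathfrak D$ is the set of diamonds, and $\mathcal E_{K^*}$ is the set of dual edges $K^*|L^*$ of $K^*$. Let $\alpha_{\mathcal D}$ be the angle between $(x_K,x_L)$ and $(x_{K^*},x_{L^*})$, $m_\sigma,m_{\sigma^*}$ lengths, $m_K,m_{K^*}$ areas, $\mathbf n_{KL}$ the unit normal to $\sigma$ outward from $K$, and $\mathbf n_{K^*L^*}$ the unit normal to $\sigma^*$ outward from $K^*$. $\Gamma_{Dir}\cap\Gamma_N$ is a set of primal vertices. $\partial\mathfrak M_{Dir}$, $\partial\mathfrak M^*_{Dir}$ are the boundary (dual) cells with center in $\Gamma_{Dir}$, and $\partial\mathfrak M_N$, $\partial\mathfrak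 M_N^*$ those with center in $\Gamma_N\setminus\Gamma_{Dir}$. $\mathcal T=(\overline{\mathfrak M},\overline{\mathfrak M^*})$, $\overline{\mathfrak M}_N=\mathfrak M\cup\partial\mathfrak M_N$, $\overline{\mathfrak M^*}_N=\mathfrak M^*\cup\partial\mathfrak M_N^*$. $\mathbb{R}^{\mathcal T_{Dir}}$ is the set of real families indexed by $\overline{\mathfrak M}_N\cup\overline{\mathfrak M^*}_N$, extended by $0$ on $\partial\mathfrak M_{Dir}\cup\partial\mathfrak M_{Dir}^*$. Write $\delta_{AB}u=u_B-u_A$. Let $\Lambda_{\mathcal D}$ be the mean of $\Lambda$ over $\mathcal D$, and $$\tau_{KL}=\frac{m_\sigma}{m_{\sigma^*}}\frac{\langle\Lambda_{\mathcal D}\mathbf n_{KL},\mathbf n_{KL}\rangle}{\sin\alpha_{\mathcal D}}>0,\quad \tau_{K^*L^*}=\frac{m_{\sigma^*}}{m_\sigma}\frac{\langle\Lambda_{\mathcal D}\mathbf n_{K^*L^*},\mathbf n_{K^*L^*}\rangle}{\sin\alpha_{\mathcal D}}>0,\quad \eta_{\mathcal D}=\frac{\langle\Lambda_{\mathcal D}\mathbf n_{KL},\mathbf n_{K^*L^*}\rangle}{\sin\alpha_{\mathcal D}}.$$ As in the paper, $\|u\|_{\mathcal T,\tau}^2=\sum_{\mathcal D\in\mathfrak D}\big(\tau_{KL}(\delta_{KL}u)^2+\tau_{K^*L^*}(\delta_{K^*L^*}u)^2\big)$ is a norm on $\mathbb R^{\mathcal T_{Dir}}$. **Discrete quantities.**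 For each cell $A$: $s_{g,A}=p_c^{-1}(p_{g,A}-p_{w,A})$, $s_{w,A}=1-s_{g,A}$; $\phi_A$ is the mean of $\phi$ over $A$; $\mathcal Z(s)=\min(\max(s,0),1)$. For cells $A,B$: $M_{\alpha,AB}^{up,\epsilon}=M_\alpha^\epsilon(s_{\alpha,B})$ if $\delta_{AB}p_\alpha\ge0$ and $M_\alpha^\epsilon(s_{\alpha,A})$ otherwise; $M_{\alpha,AB}^{min,\epsilon}=\min(M^\epsilon_\alpha(s_{\alpha,A}),M^\epsilon_\alpha(s_{\alpha,B}))$; $\frac1{\rho_{\alpha,AB}}=\frac{1}{p_{\alpha,B}-p_{\alpha,A}}\int_{p_{\alpha,A}}^{p_{\alpha,B}}\frac{dz}{\rho_\alpha(z)}$ if $p_{\alpha,A}\ne p_{\alpha,B}$, and $\frac1{\rho_\alpha(p_{\alpha,A})}$ otherwise. For each diamond $$V^{\alpha,\epsilon}_{KL}=M^{up,\epsilon}_{\alpha,KL}\tau_{KL}\delta_{KL}p_\alpha+\sqrt{M^{min,\epsilon}_{\alpha,KL}}\sqrt{M^{up,\epsilon}_{\alpha,K^*L^*}}\,\eta_{\mathcal D}\,\delta_{K^*L^*}p_\alpha,\qquad p_{c,KL}=\tau_{KL}\delta_{KL}(p_g-p_w),$$ $$V^{\alpha,\epsilon}_{K^*L^*}=M^{up,\epsilon}_{\alpha,K^*L^*}\tau_{K^*L^*}\delta_{K^*L^*}p_\alpha+\sqrt{M^{min,\epsilon}_{\alpha,K^*L^*}}\sqrt{M^{up,\epsilon}_{\alpha,KL}}\,\eta_{\mathcal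 D}\,\delta_{KL}p_\alpha,\qquad p_{c,K^*L^*}=\tau_{K^*L^*}\delta_{K^*L^*}(p_g-p_w).$$ **Scheme.** For $\epsilon,\eta\ge0$, $\alpha\in\{g,w\}$, $\mathcal F^{\epsilon,\eta}(p,p^n)$ has the following components. For $K\in\mathfrak M$: $$\mathcal F^{\epsilon,\eta}_{\alpha,K}=m_K\phi_K\big(\rho_\alpha(p_{\alpha,K})\mathcal Z(s_{\alpha,K})-\rho_\alpha(p^n_{\alpha,K})s^n_{\alpha,K}\big)-\delta t\sum_{\sigma=K|L\in\mathcal E_K}\rho_{\alpha,KL}V^{\alpha,\epsilon}_{KL}-\delta t\,\eta(-1)^{|\alpha|}\sum_{\sigma=K|L\in\mathcal E_K}\rho_{\alpha,KL}p_{c,KL}.$$ For $K^*\in\overline{\mathfrak M^*}_N$: the same formula with $K,L,\mathcal E_K$ replaced by $K^*,L^*,\mathcal E_{K^*}$. For $K\in\partial\mathfrak M_N$, adjacent to $L\in\mathfrak M$: $$\mathcal F^{\epsilon,\eta}_{\alpha,K}=-\delta t\,\rho_{\alpha,KL}\big(V^{\alpha,\epsilon}_{KL}+\eta(-1)^{|\alpha|}p_{c,KL}\big).$$ The positivity-preserving DDFV scheme is $\mathcal F^{0,0}(p,p^n)=0$. *)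

(* Defs.v *)
From HB Require Import structures.
From mathcomp Require Import all_boot all_order all_algebra.
From mathcomp Require Import all_classical all_reals all_analysis.

Set Implicit Arguments.
Unset Strict Implicit.
Unset Printing Implicit Defensive.

Import Order.TTheory GRing.Theory Num.Theory.
Import numFieldNormedType.Exports.

Local Open Scope classical_set_scope.
Local Open Scope ring_scope.

(** * Plane geometry *)

(* The canonical norm of [R * R] is the sup norm, hence a Euclidean norm here. *)
Definition dot (R : realType) (u v : R * R) : R := u.1 * v.1 + u.2 * v.2.
Definition enorm (R : realType) (u : R * R) : R := Num.sqrt (dot u u).

Definition vec (R : realType) (u : R * R) : 'cV[R]_2 :=
  \col_i (if i == 0 then u.1 else u.2).

(* <A u, v> *)
Definition mxdot (R : realType) (A : 'M[R]_2) (u v : R * R) : R :=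
  ((vec v)^T *m (A *m vec u)) 0 0.

Definition angle (R : realType) (u v : R * R) : R :=
  acos (dot u v / (enorm u * enorm v)).

Definition pt_on (R : realType) (a b : R * R) (t : R) : R * R :=
  ((1 - t) * a.1 + t * b.1, (1 - t) * a.2 + t * b.2).
Definition seg (R : realType) (a b : R * R) : set (R * R) :=
  pt_on a b @` `[0, 1].
Definition midpoint (R : realType) (a b : R * R) : R * R := pt_on a b 2^-1.

(* The open polygon whose boundary is the closed polygonal line [B]: by the
   Jordan curve theorem it is the bounded component of the complement of [B]. *)
Definition polygon (R : realType) (B : set (R * R)) : set (R * R) :=
  [set x | ~ B x /\ bounded_set (connected_component (~` B) x)].

(* [n] is the unit normal to the edge [a, b] of [A], outward from [A]. *)
Definition outward_normal (R : realType) (A : set (R * R)) (a b n : R * R) :=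
  [/\ enorm n = 1, dot n (b - a) = 0 &
      forall t, 0 < t < 1 -> \forall h \near 0^'+,
        A (pt_on a b t - (h * n.1, h * n.2)) /\
        ~ A (pt_on a b t + (h * n.1, h * n.2))].

Notation leb2 R := (@lebesgue_measure R \x @lebesgue_measure R)%E.

Definition area (R : realType) (A : set (R * R)) : R := fine ((leb2 R) A).

Definition mean (R : realType) (A : set (R * R)) (f : R * R -> R) : R :=
  (area A)^-1 * (\int[leb2 R]_(x in A) f x)%R.

(** * DDFV meshes *)

(* [right_cell i] is the second cell of an interior edge; a boundary edge has
   only a left cell, and is itself the degenerate cell on its other side.
   [vertices_of K] lists the vertices of [K] in circular order. *)
Record mesh (R : realType) := Mesh {
  domain : set (R * R);
  GammaDir : set (R * R);
  GammaN : set (R * R);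
  cell : finType;
  vertex : finType;
  iedge : finType;
  bedge : finType;
  xcell : cell -> R * R;
  xvertex : vertex -> R * R;
  vertices_of : cell -> seq vertex;
  left_cell : (iedge + bedge)%type -> cell;
  right_cell : iedge -> cell;
  ends : (iedge + bedge)%type -> bool -> vertex;
  normal : (iedge + bedge)%type -> R * R;
  dual_normal : (iedge + bedge)%type -> R * R
}.

(* Primal edges, which also index the dual edges and the diamonds. *)
Definition edge (R : realType) (m : mesh R) : finType :=
  (iedge m + bedge m)%type.

(* Primal cells, boundary edges included. *)
Definition pnode (R : realType) (m : mesh R) : finType :=
  (cell m + bedge m)%type.

(* Primal and dual cells, a dual cell being indexed by its vertex. *)
Definition node (R : realType) (m : mesh R) : finType :=
  (pnode m + vertex m)%type.

(* The edge [e] is K|L with K = side e false and L = side e true; reversing the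
   boolean reverses the roles of K and L.  Likewise the dual edge is K*|L* with
   K* = ends e false and L* = ends e true. *)
Definition side (R : realType) (m : mesh R) (e : edge m) (o : bool) : pnode m :=
  if o then match e with
            | inl i => inl (right_cell i)
            | inr b => inr b
            end
  else inl (left_cell e).

Definition xend (R : realType) (m : mesh R) (e : edge m) (o : bool) : R * R :=
  xvertex (ends e o).

Definition pcenter (R : realType) (m : mesh R) (K : pnode m) : R * R :=
  match K with
  | inl K => xcell K
  | inr b => midpoint (@xend R m (inr b) false) (@xend R m (inr b) true)
  end.

Definition center (R : realType) (m : mesh R) (A : node m) : R * R :=
  match A with
  | inl K => pcenter K
  | inr v => xvertex v
  end.

Definition xside (R : realType) (m : mesh R) (e : edge m) (o : bool) : R * R :=
  pcenter (side e o).

Definition edge_seg (R : realType) (m : mesh R) (e : edge m) : set (R * R) :=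
  seg (xend e false) (xend e true).
Definition dual_edge_seg (R : realType) (m : mesh R) (e : edge m) :
  set (R * R) := seg (xside e false) (xside e true).

Definition cell_set (R : realType) (m : mesh R) (K : cell m) : set (R * R) :=
  polygon [set x | exists (e : edge m) (o : bool),
                     side e o = inl K /\ edge_seg e x].

(* The centers of consecutive cells around the vertex are those of two cells
   sharing an edge, so the sides of the dual polygon are the dual edges, plus at
   a boundary vertex the segments joining it to the midpoints of its boundary
   edges. *)
Definition dual_set (R : realType) (m : mesh R) (v : vertex m) : set (R * R) :=
  polygon [set x | exists (e : edge m) (o : bool), ends e o = v /\
                     (dual_edge_seg e x \/
                      exists2 b : bedge m, e = inr b &
                        seg (pcenter (inr b : pnode m)) (xvertex v) x)].

Definition diamond (R : realType) (m : mesh R) (e : edge m) : set (R * R) :=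
  polygon [set x | exists o o' : bool, seg (xside e o) (xend e o') x].

Definition node_set (R : realType) (m : mesh R) (A : node m) : set (R * R) :=
  match A with
  | inl (inl K) => cell_set K
  | inl (inr b) => @edge_seg R m (inr b)
  | inr v => dual_set v
  end.

Definition diamond_angle (R : realType) (m : mesh R) (e : edge m) : R :=
  angle (xside e true - xside e false) (xend e true - xend e false).

Definition edge_length (R : realType) (m : mesh R) (e : edge m) : R :=
  enorm (xend e true - xend e false).
Definition dual_length (R : realType) (m : mesh R) (e : edge m) : R :=
  enorm (xside e true - xside e false).

(* The one-dimensional measure of a part [G] of the boundary of the domain. *)
Definition boundary_measure (R : realType) (m : mesh R) (G : set (R * R)) :
  \bar R :=
  (\sum_(b : bedge m)
    (@edge_length R m (inr b))%:E *
    lebesgue_measure [set t : R | (0 <= t <= 1)%R /\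
      G (pt_on (@xend R m (inr b) false) (@xend R m (inr b) true) t)])%E.

(* n_KL for o = false, n_LK for o = true; and the same for dual edges. *)
Definition pnormal (R : realType) (m : mesh R) (e : edge m) (o : bool) :
  R * R := (-1) ^+ o *: normal e.
Definition dnormal (R : realType) (m : mesh R) (e : edge m) (o : bool) :
  R * R := (-1) ^+ o *: dual_normal e.

Record is_mesh (R : realType) (m : mesh R) : Prop := IsMesh {
  domain_open : open (domain m);
  domain_connected : connected (domain m);
  domain_bounded : bounded_set (domain m);
  domain_boundary :
    closure (domain m) `\` domain m
      = [set x | exists b : bedge m, @edge_seg R m (inr b) x];
  boundary_split :
    closure (domain m) `\` domain m = GammaDir m `|` GammaN m;
  GammaDir_closed : closed (GammaDir m);
  GammaN_closed : closed (GammaN m);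
  GammaDirN_vertices : GammaDir m `&` GammaN m `<=` range (@xvertex R m);
  GammaDir_pos : (0 < boundary_measure m (GammaDir m))%E;
  (* vertices and edges *)
  xvertex_inj : injective (@xvertex R m);
  vertex_covered : forall v : vertex m, exists K, v \in vertices_of K;
  vertices_of_uniq : forall K : cell m, uniq (vertices_of K);
  vertices_of_size : forall K : cell m, (2 < size (vertices_of K))%N;
  edge_of_cell : forall (K : cell m) v, v \in vertices_of K ->
    exists (e : edge m) (o o' : bool),
      [/\ side e o = inl K, ends e o' = v &
          ends e (~~ o') = next (vertices_of K) v];
  cell_of_edge : forall (e : edge m) (o : bool) K, side e o = inl K ->
    exists o' : bool, ends e o' \in vertices_of K /\
      ends e (~~ o') = next (vertices_of K) (ends e o');
  left_right : forall i : iedge m, @left_cell R m (inl i) != right_cell i;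
  conforming : forall e e' : edge m, e != e' ->
    forall x, edge_seg e x -> edge_seg e' x ->
    exists o o' : bool, ends e o = ends e' o' /\ x = xend e o;
  (* primal cells *)
  xcell_in : forall K : cell m, cell_set K (xcell K);
  cell_sub : forall K : cell m, cell_set K `<=` domain m;
  cell_disjoint : forall K L : cell m, K != L ->
    cell_set K `&` cell_set L = set0;
  cell_cover :
    domain m `<=` [set x | exists K : cell m, closure (cell_set K) x];
  (* dual cells and diamonds *)
  dual_sub : forall v : vertex m, dual_set v `<=` domain m;
  diamond_sub : forall e : edge m, diamond e `<=` domain m;
  diamond_area : forall e : edge m, 0 < area (diamond e);
  diamond_sin : forall e : edge m, 0 < sin (diamond_angle e);
  normalP : forall (e : edge m) (o : bool) K, side e o = inl K ->
    outward_normal (cell_set K) (xend e false) (xend e true) (pnormal e o);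
  dual_normalP : forall (e : edge m) (o : bool),
    outward_normal (dual_set (ends e o)) (xside e false) (xside e true)
      (dnormal e o)
}.

(* Since GammaDir is contained in the boundary of the domain, an interior cell
   or vertex is never a Dirichlet node; since GammaDir and GammaN cover that
   boundary, the other boundary nodes have their center in GammaN \ GammaDir. *)
Definition dirichlet (R : realType) (m : mesh R) (A : node m) : Prop :=
  GammaDir m (center A).

(* Families indexed by the non-Dirichlet nodes, extended by 0. *)
Definition RTDir (R : realType) (m : mesh R) : set (node m -> R) :=
  [set u | forall A, dirichlet A -> u A = 0].

(** * Fluids *)

Inductive phase := gas | water.

Definition deg (a : phase) : nat := if a is water then 1%N else 0%N.

Record fluid (R : realType) := Fluid {
  pc : R -> R;
  pcinv : R -> R;
  mobility : phase -> R -> R;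
  rho : phase -> R -> R
}.

Definition piecewise_C1 (R : realType) (f : R -> R) (ts : seq R) : Prop :=
  (forall x, x \notin ts -> derivable f x 1 /\ {for x, continuous (derive1 f)}) /\
  (forall x, x \in ts ->
     cvg (derive1 f y @[y --> x^'-]) /\ cvg (derive1 f y @[y --> x^'+])).

Record is_fluid (R : realType) (f : fluid R) : Prop := IsFluid {
  pc_incr : {homo pc f : x y / x < y};
  pcK : cancel (pc f) (pcinv f);
  pcinvK : cancel (pcinv f) (pc f);
  pc_continuous : continuous (pc f);
  pcinv_continuous : continuous (pcinv f);
  pc_C1 : exists (ts : seq R) (C : R), piecewise_C1 (pc f) ts /\
    forall x, x \notin ts -> `|derive1 (pc f) x| <= C;
  pc0 : pc f 0 = 0;
  mobility_continuous : forall a, continuous (mobility f a);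
  mobility_ge0 : forall a u, 0 <= mobility f a u;
  mobility_incr : forall a, {in `[0, 1] &, {homo mobility f a : u v / u <= v}};
  mobility_le0 : forall a u, u <= 0 -> mobility f a u = 0;
  mobility_ge1 : forall a u, 1 <= u -> mobility f a u = mobility f a 1;
  mobility_total : exists2 m0 : R, 0 < m0 &
    forall u, m0 <= mobility f water (1 - u) + mobility f gas u;
  rho_derivable : forall a x, derivable (rho f a) x 1;
  rho_C1 : forall a, continuous (derive1 (rho f a));
  rho_incr : forall a, {homo rho f a : x y / x <= y};
  rho_bounded : exists rho0 rho1 : R, 0 < rho0 /\
    forall a x, rho0 <= rho f a x <= rho1
}.

(** * Medium *)

Definition is_porosity (R : realType) (Omega : set (R * R)) (phi : R * R -> R) :
  Prop :=
  measurable_fun Omega phi /\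
  exists phi0 phi1 : R, 0 < phi0 /\
    {ae leb2 R, forall x, Omega x -> phi0 <= phi x <= phi1}.

Definition is_permeability (R : realType) (Omega : set (R * R))
  (Lambda : R * R -> 'M[R]_2) : Prop :=
  (forall i j, measurable_fun Omega (fun x => Lambda x i j)) /\
  exists lo hi : R, 0 < lo <= hi /\
    {ae leb2 R, forall x, Omega x -> (Lambda x)^T = Lambda x /\
        forall v : R * R,
          lo * enorm v ^+ 2 <= mxdot (Lambda x) v v <= hi * enorm v ^+ 2}.

(** * Discrete quantities *)

Definition Lambda_mean (R : realType) (m : mesh R) (Lambda : R * R -> 'M[R]_2)
  (e : edge m) : 'M[R]_2 :=
  \matrix_(i, j) mean (diamond e) (fun x => Lambda x i j).

Definition tau (R : realType) (m : mesh R) (Lambda : R * R -> 'M[R]_2)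
  (e : edge m) : R :=
  edge_length e / dual_length e *
  (mxdot (Lambda_mean Lambda e) (pnormal e false) (pnormal e false)
     / sin (diamond_angle e)).

Definition dual_tau (R : realType) (m : mesh R) (Lambda : R * R -> 'M[R]_2)
  (e : edge m) : R :=
  dual_length e / edge_length e *
  (mxdot (Lambda_mean Lambda e) (dnormal e false) (dnormal e false)
     / sin (diamond_angle e)).

(* eta_D for the primal edge oriented by [o] and the dual edge by [o']. *)
Definition etaD (R : realType) (m : mesh R) (Lambda : R * R -> 'M[R]_2)
  (e : edge m) (o o' : bool) : R :=
  mxdot (Lambda_mean Lambda e) (pnormal e o) (dnormal e o')
    / sin (diamond_angle e).

Definition delta (R : realType) (m : mesh R) (u : node m -> R) (A B : node m) :
  R := u B - u A.

Definition sat (R : realType) (m : mesh R) (f : fluid R)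
  (p : phase -> node m -> R) (a : phase) (A : node m) : R :=
  let sg := pcinv f (p gas A - p water A) in
  match a with gas => sg | water => 1 - sg end.

Definition trunc01 (R : realType) (s : R) : R := Num.min (Num.max s 0) 1.

Definition Meps (R : realType) (f : fluid R) (eps : R) (a : phase) (u : R) : R :=
  eps + mobility f a u.

Definition Mup (R : realType) (m : mesh R) (f : fluid R) (eps : R)
  (p : phase -> node m -> R) (a : phase) (A B : node m) : R :=
  if 0 <= delta (p a) A B then Meps f eps a (sat f p a B)
  else Meps f eps a (sat f p a A).

Definition Mmin (R : realType) (m : mesh R) (f : fluid R) (eps : R)
  (p : phase -> node m -> R) (a : phase) (A B : node m) : R :=
  Num.min (Meps f eps a (sat f p a A)) (Meps f eps a (sat f p a B)).

Definition oriented_integral (R : realType) (a b : R) (g : R -> R) : R :=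
  if a <= b then (\int[lebesgue_measure]_(z in `[a, b]) g z)%R
  else - (\int[lebesgue_measure]_(z in `[b, a]) g z)%R.

(* 1 / rho_{alpha,AB} in terms of the two pressures *)
Definition inv_rho (R : realType) (r : R -> R) (pA pB : R) : R :=
  if pA != pB then (pB - pA)^-1 * oriented_integral pA pB (fun z => (r z)^-1)
  else (r pA)^-1.

Definition rho_mean (R : realType) (m : mesh R) (f : fluid R)
  (p : phase -> node m -> R) (a : phase) (A B : node m) : R :=
  (inv_rho (rho f a) (p a A) (p a B))^-1.

(* V_AB when the transverse edge of the diamond is C|D. *)
Definition Vflux (R : realType) (m : mesh R) (f : fluid R) (eps : R)
  (p : phase -> node m -> R) (a : phase) (tauAB etaABCD : R) (A B C D : node m) :
  R :=
  Mup f eps p a A B * tauAB * delta (p a) A B +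
  Num.sqrt (Mmin f eps p a A B) * Num.sqrt (Mup f eps p a C D) *
    etaABCD * delta (p a) C D.

(* V_KL with K = side e o; it does not depend on the orientation chosen for the
   dual edge, since etaD and the dual increment both change sign with it. *)
Definition V (R : realType) (m : mesh R) (Lambda : R * R -> 'M[R]_2)
  (f : fluid R) (eps : R) (p : phase -> node m -> R) (a : phase)
  (e : edge m) (o : bool) : R :=
  Vflux f eps p a (tau Lambda e) (etaD Lambda e o false)
    (inl (side e o)) (inl (side e (~~ o)))
    (inr (ends e false)) (inr (ends e true)).

(* V_K*L* with K* = ends e o *)
Definition dual_V (R : realType) (m : mesh R) (Lambda : R * R -> 'M[R]_2)
  (f : fluid R) (eps : R) (p : phase -> node m -> R) (a : phase)
  (e : edge m) (o : bool) : R :=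
  Vflux f eps p a (dual_tau Lambda e) (etaD Lambda e false o)
    (inr (ends e o)) (inr (ends e (~~ o)))
    (inl (side e false)) (inl (side e true)).

Definition pcflux (R : realType) (m : mesh R) (p : phase -> node m -> R)
  (tauAB : R) (A B : node m) : R :=
  tauAB * delta (fun C => p gas C - p water C) A B.

(** * Scheme *)

Definition accumulation (R : realType) (m : mesh R) (phi : R * R -> R)
  (f : fluid R) (p pn : phase -> node m -> R) (a : phase) (A : node m) : R :=
  area (node_set A) * mean (node_set A) phi *
  (rho f a (p a A) * trunc01 (sat f p a A) - rho f a (pn a A) * sat f pn a A).

(* The sums over the edges of K run over the pairs (e, o) with side e o = K, the
   cell on the other side being side e (~~ o). *)
Definition scheme (R : realType) (m : mesh R) (phi : R * R -> R)
  (Lambda : R * R -> 'M[R]_2) (f : fluid R) (dt eps eta : R)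
  (p pn : phase -> node m -> R) (a : phase) (A : node m) : R :=
  match A with
  | inl (inl K) =>
      accumulation phi f p pn a A
      - dt * (\sum_(e : edge m) \sum_(o : bool | side e o == inl K)
          rho_mean f p a (inl (side e o)) (inl (side e (~~ o))) *
          V Lambda f eps p a e o)
      - dt * eta * (-1) ^+ deg a *
        (\sum_(e : edge m) \sum_(o : bool | side e o == inl K)
          rho_mean f p a (inl (side e o)) (inl (side e (~~ o))) *
          pcflux p (tau Lambda e) (inl (side e o)) (inl (side e (~~ o))))
  | inl (inr b) =>
      let e : edge m := inr b in
      let L : pnode m := inl (@left_cell R m (inr b)) in
      - (dt * rho_mean f p a A (inl L) *
         (V Lambda f eps p a e true
          + eta * (-1) ^+ deg a * pcflux p (tau Lambda e) A (inl L)))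
  | inr v =>
      accumulation phi f p pn a A
      - dt * (\sum_(e : edge m) \sum_(o : bool | ends e o == v)
          rho_mean f p a (inr (ends e o)) (inr (ends e (~~ o))) *
          dual_V Lambda f eps p a e o)
      - dt * eta * (-1) ^+ deg a *
        (\sum_(e : edge m) \sum_(o : bool | ends e o == v)
          rho_mean f p a (inr (ends e o)) (inr (ends e (~~ o))) *
          pcflux p (dual_tau Lambda e) (inr (ends e o)) (inr (ends e (~~ o))))
  end.

(* F^{eps,eta}(p, p^n) = 0, its components being indexed by the phases and the
   non-Dirichlet nodes. *)
Definition solves_scheme (R : realType) (m : mesh R) (phi : R * R -> R)
  (Lambda : R * R -> 'M[R]_2) (f : fluid R) (dt eps eta : R)
  (p pn : phase -> node m -> R) : Prop :=
  forall a (A : node m), ~ dirichlet A ->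
    scheme phi Lambda f dt eps eta p pn a A = 0.

(* Main.v *)
Require Import Defs.
From HB Require Import structures.
From mathcomp Require Import all_boot all_order all_algebra.
From mathcomp Require Import all_classical all_reals all_analysis.
From mathcomp Require Import measurable_realfun.
From mathcomp Require Import ring lra.

(* Testing the scheme against the potentials G(p), with G' = 1/rho, turns the density-weighted
   fluxes into a coercive dissipation, since |eta_D|^2 < tau_KL tau_K*L*.  For eps > 0 this bounds
   the gradient of the pressures, hence the pressures because every primal and every dual cell is
   linked to a Dirichlet one, and the scheme points towards the origin on a large cube; a cubical
   Sperner lemma gives a zero.  Since M_g + M_w >= m_0, the dissipation together with the capillary
   energy controls both pressures.  For fixed eta > 0 the eta-term bounds the capillary energy
   uniformly in eps, so eps can go to 0.  With eps = 0 a maximum principle gives 0 <= s <= 1, which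
   bounds the capillary pressure independently of eta, so eta can go to 0. *)

Set Implicit Arguments.
Unset Strict Implicit.
Unset Printing Implicit Defensive.

Import Order.TTheory GRing.Theory Num.Theory.
Import numFieldNormedType.Exports.

Local Open Scope ring_scope.

(** * A cubical Sperner lemma *)

(** All the schemes are instances of one conservative network carrying an edge and a dual edge per
    diamond. The primal and dual graphs share no node and are coupled only through eta_D, so each
    must reach the Dirichlet data by itself. The truncation of the saturations keeps the
    accumulation bounded: once tested it grows linearly in the gradient, against a quadratic
    dissipation. Each parameter repairs one defect. At eps = 0 a phase may lose its mobility and
    with it the control of its gradient; the other phase is then mobile, and the capillary increment
    recovers the missing one. The maximum principle needs mobilities that really vanish, so eps goes
    to 0 before it is invoked; it also needs a term that still sees the neighbours where the
    mobility is zero, so eta stays positive until then. The bounds are proved from an inequality on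
    the tested scheme rather than from the equations. Points found on the faces of a cube satisfy
    that inequality too, which is how the faces get excluded. The Sperner lemma is computed modulo 2
    with cup products of coboundaries, in place of a triangulation of the cubes. *)

Section Characteristic2.
Variable K : comNzRingType.
Hypothesis K2 : (2 : K) = 0.

Let addrr (a : K) : a + a = 0.
Proof. by rewrite -mulr2n -mulr_natl K2 mul0r. Qed.

(** The terms at (i, j) and (j, i) cancel in characteristic 2; [enum_rank] selects one pair of each
    kind. *)
Lemma sum_sym_eq0 (I : finType) (w : I -> I -> K) :
  (forall i, w i i = 0) -> (forall i j, w i j = w j i) ->
  \sum_i \sum_j w i j = 0.
Proof.
move=> w0 wC; pose lt (i j : I) := (enum_rank i < enum_rank j)%N.
have -> : \sum_i \sum_j w i j =
    \sum_i \sum_(j | lt i j) w i j + \sum_i \sum_(j | lt j i) w i j.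
  rewrite -big_split; apply: eq_bigr => i _ /=.
  rewrite (bigID (lt i)) /=; congr (_ + _).
  rewrite big_mkcond [RHS]big_mkcond; apply: eq_bigr => j _.
  rewrite /lt -leqNgt leq_eqVlt.
  case: eqP => [/val_inj/enum_rank_inj ->|_] /=; last by [].
  by rewrite ltnn w0.
have -> : \sum_i \sum_(j | lt j i) w i j = \sum_i \sum_(j | lt i j) w i j.
  rewrite (exchange_big_dep xpredT) //=; apply: eq_bigr => i _.
  by apply: eq_bigr => j _; rewrite wC.
exact: addrr.
Qed.

(** * Cup products of coboundaries on lattice cubes *)

Section Cubes.
Variable I : finType.
Implicit Types (x y : I -> nat) (s : seq I) (J : {set I}).
Implicit Types (u F G : (I -> nat) -> K) (us : seq ((I -> nat) -> K)).

Definition upd x i (a : nat) : I -> nat := fun j => if j == i then a else x j.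
Definition inc x i : I -> nat := upd x i (x i).+1.

Lemma updC x i j a b : i != j -> upd (upd x i a) j b = upd (upd x j b) i a.
Proof.
move=> ij; apply/funext => l; rewrite /upd.
by case: (eqVneq l j) => // ->; rewrite eq_sym (negPf ij).
Qed.

Lemma inc_upd x i j a : i != j -> inc (upd x i a) j = upd (inc x j) i a.
Proof.
move=> ij; rewrite /inc updC //; congr (upd (upd _ _ _.+1) _ _).
by rewrite /upd eq_sym (negPf ij).
Qed.

Lemma incC x i j : inc (inc x i) j = inc (inc x j) i.
Proof.
have [->//|ij] := eqVneq i j.
rewrite {1}/inc [inc x i]/inc updC // [RHS]/inc /inc.
by congr (upd (upd _ _ _.+1) _ _.+1); rewrite /upd ?(negPf ij) // eq_sym (negPf ij).
Qed.

(* The value at the cube [x + [0, 1]^J] of the cup product du_1 ... du_m of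
   the coboundaries of the functions in [us], a sum over monotone paths. *)
Fixpoint cup us J x : K :=
  if us is u :: us' then
    \sum_(j in J) (u (inc x j) - u x) * cup us' (J :\ j) (inc x j)
  else 1.

(** A product of coboundaries is a cocycle: its values on the far faces and on the near faces of a
    cube have the same sum. Both sides become sums over ordered pairs of directions i, j; for the
    near faces the induction hypothesis first moves the remaining factors to the far corner. Modulo
    2 the difference has the coefficient [u (inc (inc x i) j) + u x], symmetric in i and j, and
    [sum_sym_eq0] applies. *)
Lemma cup_closed us J x : #|J| = (size us).+1 ->
  \sum_(j in J) cup us (J :\ j) (inc x j) = \sum_(j in J) cup us (J :\ j) x.
Proof.
elim: us J x => [//|u us IH] J x cJ.
pose w i j := if [&& i \in J, j \in J & i != j] then
  cup us (J :\ i :\ j) (inc (inc x i) j) else 0.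
have wC i j : w i j = w j i.
  rewrite /w incC [J :\ i :\ j]finset.setDDl [J :\ j :\ i]finset.setDDl finset.setUC.
  by rewrite eq_sym andbCA.
have two (f : I -> I -> K) :
    \sum_(i in J) \sum_(j in J :\ i) f i j =
    \sum_i \sum_j if [&& i \in J, j \in J & i != j] then f i j else 0.
  rewrite big_mkcond; apply: eq_bigr => i _.
  case: ifP => iJ; last by rewrite big1.
  rewrite big_mkcond; apply: eq_bigr => j _.
  by rewrite !inE eq_sym andbC.
have e1 : \sum_(j in J) cup (u :: us) (J :\ j) (inc x j) =
    \sum_i \sum_j (u (inc (inc x i) j) - u (inc x i)) * w i j.
  rewrite /= two; apply: eq_bigr => i _; apply: eq_bigr => j _.
  by rewrite /w; case: ifP; rewrite ?mulr0.
have e2 : \sum_(j in J) cup (u :: us) (J :\ j) x =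
    \sum_i \sum_j (u (inc x i) - u x) * w i j.
  rewrite /= two exchange_big /=.
  transitivity (\sum_(i in J) (u (inc x i) - u x) *
      \sum_(j in J :\ i) cup us (J :\ i :\ j) (inc x i)).
    rewrite [RHS]big_mkcond; apply: eq_bigr => i _.
    case: ifP => iJ; last by rewrite big1 // => j _; rewrite andbF.
    rewrite mulr_sumr [RHS]big_mkcond; apply: eq_bigr => j _.
    rewrite !inE andbC /=; case: ifP => // _.
    by rewrite [J :\ i :\ j]finset.setDDl [J :\ j :\ i]finset.setDDl finset.setUC.
  transitivity (\sum_(i in J) (u (inc x i) - u x) *
      \sum_(j in J :\ i) cup us (J :\ i :\ j) (inc (inc x i) j)).
    apply: eq_bigr => i iJ; rewrite IH //.
    by move: cJ; rewrite (cardsD1 i) iJ => -[].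
  rewrite [LHS](eq_bigr _ (fun i _ => mulr_sumr _ _ _ _)).
  rewrite two; apply: eq_bigr => i _; apply: eq_bigr => j _.
  by rewrite /w; case: ifP; rewrite ?mulr0.
apply/eqP; rewrite -subr_eq0 e1 e2 -sumrB; apply/eqP.
under eq_bigr do rewrite -sumrB.
apply: sum_sym_eq0 => [i|i j]; first by rewrite /w eqxx !andbF !mulr0 subrr.
rewrite (wC i j) (incC x i j) -!mulrBl; congr (_ * _).
by apply/eqP; rewrite -subr_eq0; apply/eqP; rewrite -(mul0r (u (inc x j) - u (inc x i))) -K2; ring.
Qed.

(** No path in the directions [J] moves the coordinate [c], so the factor of [u] is a difference of
    equal values. *)
Lemma cup_eq0 us J x u c : u \in us -> c \notin J ->
  (forall y, y c = x c -> u y = u x) -> cup us J x = 0.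
Proof.
elim: us J x => [//|v us IH] J x; rewrite inE => /orP[/eqP <-|uus] cJ ux /=;
    apply: big1 => j jJ; have cj : c != j by apply: contraNneq cJ => ->.
  by rewrite ux ?subrr ?mul0r // /inc /upd (negPf cj).
have xj : inc x j c = x c by rewrite /inc /upd (negPf cj).
rewrite [cup _ _ _]IH ?mulr0 //; first by rewrite !inE (negPf cJ) andbF.
by move=> y; rewrite xj => yx; rewrite ux // [RHS]ux.
Qed.

Lemma cup_neq0 us J x : cup us J x != 0 -> forall u, u \in us ->
  exists p q, [/\ forall i, (x i <= p i <= (x i).+1)%N,
    forall i, (x i <= q i <= (x i).+1)%N & u p != u q].
Proof.
(* The induction follows one path with a nonzero term, at the current vertex [y]. The second
   invariant says that a direction still in [J] has not been used, which keeps the path inside the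
   unit cube at [x]. *)
suff H y : (forall i, (x i <= y i)%N) ->
    (forall i, (y i + (i \in J) <= (x i).+1)%N) -> cup us J y != 0 ->
    forall u, u \in us -> exists p q, [/\ forall i, (x i <= p i <= (x i).+1)%N,
    forall i, (x i <= q i <= (x i).+1)%N & u p != u q].
  by apply: H => // i; case: (i \in J); rewrite ?addn1 ?addn0.
elim: us J y => [//|v us IH] J y xy yx /= H u.
have {H} [j jJ vj] : exists2 j, j \in J &
    (v (inc y j) - v y) * cup us (J :\ j) (inc y j) != 0.
  apply/exists_inP; apply: contraNT H; rewrite negb_exists_in => /forall_inP H.
  by apply/eqP/big1 => j /H; rewrite negbK => /eqP.
have cj : cup us (J :\ j) (inc y j) != 0.
  by apply: contraNneq vj => ->; rewrite mulr0.
have {}vj : v (inc y j) != v y.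
  by apply: contraNneq vj => ->; rewrite subrr mul0r.
have xj i : (x i <= inc y j i)%N.
  by rewrite /inc /upd; case: eqP => [->|//]; apply: leqW.
have jx i : (inc y j i + (i \in J :\ j) <= (x i).+1)%N.
  rewrite /inc /upd !inE; case: eqP => [->|_] //=.
  by have := yx j; rewrite jJ addn1 addn0.
rewrite inE => /orP[/eqP ->|]; last exact: IH cj _.
exists (inc y j), y; split => // i; rewrite ?xj ?xy /=.
  exact: leq_trans (leq_addr _ _) (jx i).
exact: leq_trans (leq_addr _ _) (yx i).
Qed.

(** * Summation over a box *)

Variable k : nat.

Fixpoint boxsum s F x : K :=
  if s is i :: s' then \sum_(0 <= a < k) boxsum s' F (upd x i a) else F x.

Lemma boxsum_rem s F x j : uniq s -> j \in s ->
  boxsum s F x = boxsum (j :: rem j s) F x.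
Proof.
elim: s x => [//|i s IH] x /= /andP[nis us]; rewrite inE.
have [-> //|ij] := eqVneq j i; move=> /= js.
under eq_bigr do rewrite (IH _ us js) /=.
rewrite exchange_big /=.
by apply: eq_bigr => a _; apply: eq_bigr => b _; rewrite updC // eq_sym.
Qed.

Lemma eq_boxsum s F G x : (forall y, (forall i, i \notin s -> y i = x i) ->
  F y = G y) -> boxsum s F x = boxsum s G x.
Proof.
elim: s x => [|i s IH] x FG /=; first exact: FG.
apply: eq_bigr => a _; apply: IH => y yx; apply: FG => j.
by rewrite inE negb_or => /andP[ji js]; rewrite yx // /upd (negPf ji).
Qed.

Lemma boxsum_sum (T : finType) (P : pred T) s (F : T -> (I -> nat) -> K) x :
  boxsum s (fun y => \sum_(t | P t) F t y) x = \sum_(t | P t) boxsum s (F t) x.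
Proof.
elim: s x => [//|i s IH] x /=; rewrite exchange_big /=.
by apply: eq_bigr => a _; rewrite IH.
Qed.

Lemma boxsumB s F G x :
  boxsum s (fun y => F y - G y) x = boxsum s F x - boxsum s G x.
Proof.
elim: s x => [//|i s IH] x /=; rewrite -sumrB.
by apply: eq_bigr => a _; rewrite IH.
Qed.

Lemma boxsum_inc s F x i : i \notin s ->
  boxsum s (fun y => F (inc y i)) x = boxsum s F (inc x i).
Proof.
elim: s x => [//|j s IH] x; rewrite inE negb_or => /andP[ij js] /=.
by apply: eq_bigr => a _; rewrite IH // inc_upd // eq_sym.
Qed.

Lemma boxsum_telescope s F x i : uniq s -> i \in s ->
  boxsum s (fun y => F (inc y i) - F y) x =
  boxsum (rem i s) F (upd x i k) - boxsum (rem i s) F (upd x i 0%N).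
Proof.
move=> us si; rewrite (boxsum_rem _ _ us si) /=.
have nis : i \notin rem i s by rewrite mem_rem_uniqF.
under eq_bigr => a _.
  rewrite boxsumB boxsum_inc //.
  have -> : inc (upd x i a) i = upd x i a.+1.
    by apply/funext => j; rewrite /inc /upd eqxx; case: eqP.
  over.
by rewrite telescope_sumr.
Qed.

Lemma boxsum_neq0 s F x : boxsum s F x != 0 ->
  exists2 y, F y != 0 & forall i, if i \in s then is_true (y i < k)%N else y i = x i.
Proof.
elim: s x => [|i s IH] x /=; first by exists x.
move=> H; have {H} [a ak ha] : exists2 a, (a < k)%N &
    boxsum s F (upd x i a) != 0.
  apply: contrapT => nex; move/eqP: H; apply; rewrite big_mkord big1 // => a _.
  by apply/eqP; apply: contrapT => na; apply: nex; exists a => //; apply/negP.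
have [y Fy yb] := IH _ ha; exists y => // j; have := yb j.
rewrite inE /upd; case: (j \in s); first by rewrite orbT.
by rewrite orbF; case: eqP => // _ ->.
Qed.

Section Labels.
Variable lab : I -> (I -> nat) -> K.
Hypothesis lab0 : forall i y, y i = 0%N -> lab i y = 0.
Hypothesis labk : forall i y, y i = k -> lab i y = 1.

(** A degree computation by a discrete Stokes formula. By [cup_closed] the product is the coboundary
    of [lab i] times the product of the other factors, so its sum telescopes to the faces of the
    box. On the face of height k in direction i the label is 1, which gives the induction
    hypothesis; on the opposite face it is 0. On a face orthogonal to another direction j the label
    [lab j] is constant, and its factor vanishes by [cup_eq0]. *)
Lemma boxsum_cup s x : uniq s ->
  boxsum s (cup [seq lab i | i <- s] [set i in s]) x = 1.
Proof.
elim: s x => [//|i s IH] x us; have /andP[nis us'] := us.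
set J := [set j in i :: s]; pose ls := [seq lab i | i <- s].
pose H j y := lab i y * cup ls (J :\ j) y.
have cJ : #|J| = (size ls).+1 by rewrite cardsE (card_uniqP us) /= size_map.
have -> : boxsum (i :: s) (cup [seq lab i | i <- i :: s] J) x =
    boxsum (i :: s) (fun y => \sum_(j in J) (H j (inc y j) - H j y)) x.
  apply: eq_boxsum => y _ /=.
  have := cup_closed y cJ => /eqP; rewrite -subr_eq0 => /eqP cl.
  (* The discrete Leibniz rule leaves [lab i y] times the cocycle relation, which is zero. *)
  transitivity (\sum_(j in J) (H j (inc y j) - H j y) - lab i y *
     (\sum_(j in J) cup ls (J :\ j) (inc y j)
      - \sum_(j in J) cup ls (J :\ j) y)); last by rewrite cl mulr0 subr0.
  rewrite -sumrB mulr_sumr -sumrB; apply: eq_bigr => j _; rewrite /H; ring.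
rewrite boxsum_sum.
have Ji : J :\ i = [set j in s].
  apply/setP => j; rewrite !inE; case: eqP => [->|_] //=.
  by rewrite (negPf nis).
pose B j := boxsum (i :: s) (fun y => H j (inc y j) - H j y) x.
rewrite -/(\sum_(j in J) B j).
have tel j : j \in i :: s -> B j = boxsum (rem j (i :: s)) (H j) (upd x j k)
  - boxsum (rem j (i :: s)) (H j) (upd x j 0%N).
  by move=> js; rewrite /B boxsum_telescope.
rewrite (bigD1 i) /=; last by rewrite !inE eqxx.
rewrite [X in _ + X]big1 => [|j /andP[jJ ji]].
  rewrite addr0 tel ?inE ?eqxx // [rem i _]/= eqxx.
  rewrite [X in X - _](_ : _ = 1) ?[X in _ - X](_ : _ = 0) ?subr0 //.
    rewrite (@eq_boxsum _ _ (fun y => 0 - 0)) ?boxsumB ?subrr // => y yx.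
    by rewrite /H lab0 ?mul0r ?subrr // yx // /upd eqxx.
  rewrite -(IH (upd x i k) us'); apply: eq_boxsum => y yx.
  by rewrite /H labk ?mul1r -?Ji // yx // /upd eqxx.
have js : j \in i :: s by move: jJ; rewrite inE.
rewrite tel //.
have js' : j \in s by move: js; rewrite inE (negPf ji).
have E a : (forall y y', y j = a -> y' j = a -> lab j y = lab j y') ->
    boxsum (rem j (i :: s)) (H j) (upd x j a) = 0.
  move=> la; rewrite (@eq_boxsum _ _ (fun y => 0 - 0)) ?boxsumB ?subrr // => y yx.
  have yj : y j = a by rewrite yx ?mem_rem_uniqF // /upd eqxx.
  rewrite ?subrr /H (@cup_eq0 _ _ _ (lab j) j) ?mulr0 //.
  - exact: map_f.
  - by rewrite !inE eqxx.
  - by move=> z; rewrite yj => zj; apply: la.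
rewrite (E k) => [|y y' yj yj']; last by rewrite !labk.
by rewrite (E 0%N) ?subrr // => y y' yj yj'; rewrite !lab0.
Qed.

End Labels.

End Cubes.
End Characteristic2.

(** With labels read in ['F_2] the products over the unit cubes sum to 1, so one of them is nonzero,
    and then each of its factors takes both values on that cube. *)
Theorem cubical_sperner (I : finType) (k : nat) (lab : I -> (I -> nat) -> bool) :
  (forall i y, y i = 0%N -> ~~ lab i y) -> (forall i y, y i = k -> lab i y) ->
  exists2 x, forall i, (x i < k)%N & forall i, exists p q,
    [/\ forall j, (x j <= p j <= (x j).+1)%N,
        forall j, (x j <= q j <= (x j).+1)%N, lab i p & ~~ lab i q].
Proof.
move=> l0 lk; pose lab' i y : 'F_2 := (lab i y)%:R.
have K2 : (2 : 'F_2) = 0 by apply/eqP.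
have l0' i y : y i = 0%N -> lab' i y = 0 by move=> /l0; rewrite /lab' => /negPf ->.
have lk' i y : y i = k -> lab' i y = 1 by move=> /lk; rewrite /lab' => ->.
have E := boxsum_cup K2 l0' lk' (fun=> 0%N) (enum_uniq I).
have /boxsum_neq0[x cx xk] :
    boxsum k (enum I) (cup [seq lab' i | i <- enum I] [set i in enum I])
      (fun=> 0%N) != 0 by rewrite E oner_neq0.
exists x => [i|i]; first by have := xk i; rewrite mem_enum.
have [|p [q [xp xq]]] := cup_neq0 cx (u := lab' i); first by rewrite map_f ?mem_enum.
rewrite /lab'; case: (boolP (lab i p)); case: (boolP (lab i q)); rewrite ?eqxx //.
- by move=> *; exists p, q.
- by move=> *; exists q, p; split.
Qed.

(** * Complementarity problems on a cube *)

Local Open Scope classical_set_scope.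
Local Open Scope ring_scope.

(* The lattice points are labelled by the signs of F; the ever smaller cubes that carry both labels
   in every direction accumulate at a solution. *)
Theorem cube_complementarity (R : realType) (n : nat)
    (F : 'rV[R]_n -> 'I_n -> R) (r : R) : 0 < r ->
  (forall i, continuous (F^~ i)) ->
  exists2 x : 'rV[R]_n, (forall i, `|x 0 i| <= r) &
    forall i, [\/ F x i = 0, x 0 i = r /\ F x i <= 0 | x 0 i = - r /\ 0 <= F x i].
Proof.
move=> r0 Fc.
pose pt k (y : 'I_n -> nat) : 'rV[R]_n := \row_i (- r + 2 * r * ((y i)%:R / k%:R)).
(* On the two faces of direction i the label is forced, whatever the sign of [F], as the Sperner
   lemma demands. This is where the alternatives on the faces come from: there, one of the two
   labels says nothing about [F]. *)
pose lab k i y := (y i != 0%N) && ((y i == k) || (0 < F (pt k y) i)).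
have sp k : {x : 'I_n -> nat | (forall i, (x i < k.+1)%N) /\
    forall i, exists p q, [/\ forall j, (x j <= p j <= (x j).+1)%N,
        forall j, (x j <= q j <= (x j).+1)%N, lab k.+1 i p & ~~ lab k.+1 i q]}.
  apply: cid; have [||x xk H] := @cubical_sperner 'I_n k.+1 (lab k.+1).
  - by move=> i y yi; rewrite /lab yi.
  - by move=> i y yi; rewrite /lab yi eqxx.
  - by exists x.
pose c k := pt k.+1 (sval (sp k)).
pose B := [set v : 'rV[R]_n | forall i, v 0 i \in `[- r, r]].
have cB k : B (c k).
  move=> i; rewrite /= in_itv /= mxE; have [/(_ i) xk _] := svalP (sp k).
  set t : R := _%:R / _.
  have t0 : 0 <= t by exact: divr_ge0.
  have t1 : t <= 1 by rewrite ler_pdivrMr ?ltr0n // mul1r ler_nat ltnW.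
  by apply/andP; split; nra.
have cptB : compact B by apply: (@rV_compact _ _ (fun=> `[- r, r]%classic)) => i; exact: segment_compact.
have [p [Bp clp]] : B `&` cluster (c @ \oo) !=set0.
  by apply: cptB; exists 0%N => // k _; exact: cB.
have pr i : `|p 0 i| <= r by have := Bp i; rewrite /= in_itv /= ler_norml.
have key U : nbhs p U -> exists k x, (forall y, (forall j, (x j <= y j <= (x j).+1)%N) -> U (pt k.+1 y)) /\
    forall i, exists p q, [/\ forall j, (x j <= p j <= (x j).+1)%N,
        forall j, (x j <= q j <= (x j).+1)%N, lab k.+1 i p & ~~ lab k.+1 i q].
  move=> /nbhs_ballP[e /= e0 eU].
  (* Beyond this rank the cubes have side less than e / 2; the other half of e is left for the
     distance from [p] to the corner of the cube. *)
  pose K := Num.truncn (4 * r / e).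
  have H1 : (c @ \oo) [set v | exists2 k, (K <= k)%N & v = c k].
    by exists K => // k /= Kk; exists k.
  have [v [/= [k Kk ->] bk]] := clp _ _ H1 (nbhsx_ballx p _ (divr_gt0 e0 (ltr0n R 2))).
  exists k, (sval (sp k)); split; last by have [] := svalP (sp k).
  move=> y yx; apply: eU; split => // i j; rewrite ord1.
  have [_ /(_ 0 j)] := bk; rewrite /ball /= !mxE => H2.
  have Kr : 4 * r / e < k.+1%:R.
    by apply: lt_le_trans (truncnS_gt _) _; rewrite ler_nat.
  have /andP[y1 y2] := yx j.
  set x := sval (sp k) in y1 y2 H2.
  have k0 : 0 < k.+1%:R :> R by rewrite ltr0n.
  have y1' : (x j)%:R / k.+1%:R <= (y j)%:R / k.+1%:R :> R by rewrite ler_pM2r ?invr_gt0 // ler_nat.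
  have y2' : (y j)%:R / k.+1%:R <= (x j)%:R / k.+1%:R + k.+1%:R^-1 :> R.
    by rewrite -[X in _ <= _ + X]mul1r -mulrDl ler_pM2r ?invr_gt0 // natr1 ler_nat.
  have y3 : 2 * r * k.+1%:R^-1 < e / 2.
    rewrite ltr_pdivrMr // mulrC; move: Kr; rewrite ltr_pdivrMr // => ?; nra.
  rewrite /= in H2; move: y1' y2' H2.
  set a := _ / _; set b := _ / _ => y1' y2' H2.
  move: H2; rewrite !ltr_norml => /andP[? ?].
  set g := _^-1 in y2' y3.
  apply/andP; split; nra.
exists p => // i.
have Fi U : nbhs (F p i) U -> \forall v \near nbhs p, U (F v i) by move/(Fc i p).
have Pi U : nbhs (p 0 i) U -> \forall v \near nbhs p, U ((v : 'rV[R]_n) 0 i) by move=> pU; exact: (@coord_continuous R 1 n 0 i p U pU).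
case: (ltgtP (F p i) 0) => Fp0; last by constructor 1.
- constructor 2; split => //.
  have [//|pir] := eqVneq (p 0 i) r.
  have pl : p 0 i < r by rewrite lt_neqAle pir /=; have := pr i; rewrite ler_norml => /andP[].
  have [k [x [Ux /(_ i)]]] := key _ (filterI (Fi _ (lt_nbhsl Fp0)) (Pi _ (lt_nbhsl pl))).
  move=> [y [_ [/Ux[/= U1 U2] _ + _]]]; rewrite /lab => /andP[_ /orP[/eqP yk|]].
    by move: U2; rewrite mxE yk divff ?pnatr_eq0 //; lra.
  by rewrite ltNge (ltW U1).
- constructor 3; split => //.
  have [//|pir] := eqVneq (p 0 i) (- r).
  have pl : - r < p 0 i.
    by rewrite lt_neqAle eq_sym pir /=; have := pr i; rewrite ler_norml => /andP[].
  have [k [x [Ux /(_ i)]]] := key _ (filterI (Fi _ (lt_nbhsr Fp0)) (Pi _ (lt_nbhsr pl))).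
  move=> [_ [y [_ /Ux[/= U1 U2] _]]]; rewrite /lab U1 orbT andbT negbK => /eqP y0.
  by move: U2; rewrite mxE y0 mul0r mulr0 addr0 ltxx.
Qed.

(** * Mean densities *)

Section Density.
Variables (R : realType) (r : R -> R) (b0 b1 : R).
Hypotheses (rc : continuous r) (r_nd : {homo r : x y / x <= y}) (b0gt0 : 0 < b0)
  (rb : forall x, b0 <= r x <= b1).
Notation mu := (@lebesgue_measure R).
Notation h := (fun z => (r z)^-1).

Lemma density_gt0 x : 0 < r x.
Proof. by have /andP[+ _] := rb x; apply: lt_le_trans. Qed.

Lemma density_ub_gt0 : 0 < b1.
Proof. by have /andP[_] := rb 0; apply: lt_le_trans (density_gt0 _). Qed.

Lemma inv_density_itv x : b1^-1 <= (r x)^-1 <= b0^-1.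
Proof.
by have /andP[? ?] := rb x; rewrite !lef_pV2 ?posrE ?density_gt0 ?density_ub_gt0 //; apply/andP.
Qed.

Lemma inv_density_ni x y : x <= y -> (r y)^-1 <= (r x)^-1.
Proof. by move=> /r_nd; rewrite lef_pV2 ?posrE ?density_gt0. Qed.

Lemma inv_density_continuous : continuous h.
Proof. by move=> x; apply: cvgV; [rewrite gt_eqF ?density_gt0|exact: rc]. Qed.

Lemma inv_density_integrable a b : mu.-integrable `[a, b] (EFin \o h).
Proof.
apply: continuous_compact_integrable; first exact: segment_compact.
by apply: continuous_subspaceT; exact: inv_density_continuous.
Qed.

Lemma Rintegral_inv_density_add a b c : a <= b -> b <= c ->
  (\int[mu]_(z in `[a, b]) h z + \int[mu]_(z in `[b, c]) h z =
   \int[mu]_(z in `[a, c]) h z)%R.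
Proof.
move=> ab bc; have := @Rintegral_itvB _ h (BLeft a) (BRight c) b (inv_density_integrable a c).
rewrite !bnd_simp => /(_ ab bc) E.
rewrite -(@Rintegral_itv_obnd_cbnd _ b (BRight c)); first by rewrite -E addrC subrK.
by apply: integrableS (inv_density_integrable b c) => //; apply: subset_itv_oc_cc.
Qed.

Lemma oriented_integral_add a b c :
  oriented_integral a b h + oriented_integral b c h = oriented_integral a c h.
Proof.
have A := Rintegral_inv_density_add; rewrite /oriented_integral.
have E x : (\int[mu]_(z in `[x, x]) h z = 0)%R by rewrite set_itv1 Rintegral_set1.
case: (leP a b) => ab; case: (leP b c) => bc; case: (leP a c) => ac.
- exact: A.
- by have := lt_le_trans ac (le_trans ab bc); rewrite ltxx.
- have := A a c b ac (ltW bc); lra.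
- have := A c a b (ltW ac) ab; lra.
- have := A b a c (ltW ab) ac; lra.
- have := A b c a bc (ltW ac); lra.
- by have := lt_trans bc ab; rewrite ltNge ac.
- have := A c b a (ltW bc) (ltW ab); lra.
Qed.

Definition density_potential x := oriented_integral 0 x h.

Lemma density_potentialB a b :
  oriented_integral a b h = density_potential b - density_potential a.
Proof. by rewrite /density_potential -(oriented_integral_add 0 a b) addrC addKr. Qed.

Lemma density_potential0 : density_potential 0 = 0.
Proof. by rewrite /density_potential /oriented_integral lexx set_itv1 Rintegral_set1. Qed.

Lemma oriented_integral_itv a b : a <= b ->
  (b - a) * (r b)^-1 <= oriented_integral a b h <= (b - a) * (r a)^-1.
Proof.
move=> ab; rewrite /oriented_integral ab.
have C (k : R) : (\int[mu]_(z in `[a, b]) k = (b - a) * k)%R.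
  rewrite Rintegral_cst // mulrC; congr (_ * _); transitivity (fine (mu `[a, b])) => //.
  rewrite lebesgue_measure_itv /= lte_fin; case: ltgtP ab => //= -> _.
  by rewrite subrr.
have I (k : R) : mu.-integrable `[a, b] (EFin \o cst k).
  apply: continuous_compact_integrable; first exact: segment_compact.
  by apply: continuous_subspaceT => x; exact: cvg_cst.
rewrite -!C; apply/andP; split; apply: le_Rintegral => //=;
  try exact: inv_density_integrable; try exact: I;
  by move=> x; rewrite in_itv /= => /andP[ax xb]; apply: inv_density_ni.
Qed.

(** The inverse mean density is the divided difference of the potential. Hence a mean density times
    the increment of the potential is exactly a pressure increment, and no density remains in the
    dissipation. *)
Lemma inv_rho_potential a b :
  inv_rho r a b * (b - a) = density_potential b - density_potential a.
Proof.
rewrite /inv_rho; case: eqVneq => [->|ab] /=; first by rewrite !subrr mulr0.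
by rewrite mulrAC mulVf ?subr_eq0 1?eq_sym // mul1r density_potentialB.
Qed.

Lemma inv_rhoC a b : inv_rho r a b = inv_rho r b a.
Proof.
rewrite /inv_rho eq_sym; case: eqVneq => [->//|ab] /=.
by rewrite !density_potentialB -[in RHS]opprB invrN mulNr -mulrN opprB.
Qed.

Lemma inv_rho_itv a b : a <= b -> (r b)^-1 <= inv_rho r a b <= (r a)^-1.
Proof.
rewrite le_eqVlt => /orP[/eqP ->|ab]; first by rewrite /inv_rho eqxx lexx.
have := oriented_integral_itv (ltW ab); rewrite density_potentialB -inv_rho_potential.
by rewrite ![_ * (r _)^-1]mulrC !ler_pM2r ?subr_gt0.
Qed.

Lemma inv_rho_bound a b : b1^-1 <= inv_rho r a b <= b0^-1.
Proof.
wlog ab : a b / a <= b.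
  by move=> H; case: (leP a b) => [/H//|/ltW /H]; rewrite inv_rhoC.
have /andP[h1 h2] := inv_rho_itv ab.
have /andP[h3 _] := inv_density_itv b; have /andP[_ h4] := inv_density_itv a.
by rewrite (le_trans h3) //= (le_trans h2).
Qed.

Lemma inv_rho_gt0 a b : 0 < inv_rho r a b.
Proof.
have /andP[+ _] := inv_rho_bound a b; apply: lt_le_trans.
by rewrite invr_gt0 density_ub_gt0.
Qed.

Lemma density_potential_continuous : continuous density_potential.
Proof.
move=> x; apply/cvgrPdist_le => e e0.
near=> y; rewrite -inv_rho_potential normrM ger0_norm ?(ltW (inv_rho_gt0 _ _)) //.
have /andP[_ /ler_wpM2r] := inv_rho_bound y x.
move=> /(_ `|x - y| (normr_ge0 _)) /le_trans; apply.
rewrite mulrC ler_pdivrMr //; near: y.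
by apply: cvgr_dist_le => //; apply: mulr_gt0.
Unshelve. all: by end_near. Qed.

Lemma density_potential_bound x : `|density_potential x| <= b0^-1 * `|x|.
Proof.
have := inv_rho_potential 0 x; rewrite density_potential0 !subr0 => <-.
rewrite normrM ger0_norm ?(ltW (inv_rho_gt0 _ _)) // ler_wpM2r //.
by have /andP[] := inv_rho_bound 0 x.
Qed.

Lemma density_potential_sg x : 0 <= x * density_potential x.
Proof.
have := inv_rho_potential 0 x; rewrite density_potential0 !subr0 => <-.
by rewrite mulrCA mulr_ge0 ?(ltW (inv_rho_gt0 _ _)) // -expr2 sqr_ge0.
Qed.

(** Off the diagonal this is a quotient of continuous functions; on the diagonal monotonicity of [r]
    squeezes the mean between the values of 1 / r at the two endpoints. *)
Lemma inv_rho_continuous (T : topologicalType) (u v : T -> R) :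
  continuous u -> continuous v -> continuous (fun t => inv_rho r (u t) (v t)).
Proof.
move=> uc vc t; have [uv|uv] := eqVneq (u t) (v t).
  have E : inv_rho r (u t) (v t) = (r (v t))^-1 by rewrite /inv_rho uv eqxx.
  rewrite /continuous_at E; apply/cvgrPdist_lt => e e0.
  have U : \forall s \near t, `|(r (u t))^-1 - (r (u s))^-1| < e.
    by apply: cvgr_dist_lt => //; exact: (continuous_comp (uc t) (inv_density_continuous (x := u t))).
  have V : \forall s \near t, `|(r (v t))^-1 - (r (v s))^-1| < e.
    by apply: cvgr_dist_lt => //; exact: (continuous_comp (vc t) (inv_density_continuous (x := v t))).
  apply: filterS2 U V => s; rewrite uv !ltr_norml => /andP[? ?] /andP[? ?].
  by case: (leP (u s) (v s)) => [/inv_rho_itv|/ltW/inv_rho_itv];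
    rewrite 1?(inv_rhoC (v s)) => /andP[? ?]; apply/andP; split; lra.
have N : \forall s \near t, u s != v s.
  have : \forall s \near t, 0 < `|v s - u s|.
    have : (fun s => `|v s - u s|) @ t --> `|v t - u t|.
      by apply: cvg_norm; apply: cvgB; [exact: vc|exact: uc].
    by move/cvgr_gt; apply; rewrite normr_gt0 subr_eq0 eq_sym.
  by apply: filterS => s; rewrite normr_gt0 subr_eq0 eq_sym.
have E : inv_rho r (u t) (v t) =
    (v t - u t)^-1 * (density_potential (v t) - density_potential (u t)).
  by rewrite /inv_rho uv density_potentialB.
have L : (fun s => (v s - u s)^-1 * (density_potential (v s) - density_potential (u s)))
    @ t --> (v t - u t)^-1 * (density_potential (v t) - density_potential (u t)).
  apply: cvgM; first by apply: cvgV; [rewrite subr_eq0 eq_sym|apply: cvgB; [exact: vc|exact: uc]].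
  by apply: cvgB; [apply: (continuous_comp (vc t) (density_potential_continuous (x := v t)))|
    apply: (continuous_comp (uc t) (density_potential_continuous (x := u t)))].
rewrite /continuous_at E; apply: cvg_trans L; apply: near_eq_cvg; near=> s.
have us : u s != v s by near: s.
by rewrite /inv_rho us density_potentialB.
Unshelve. all: by end_near. Qed.

End Density.

(** * The scheme as a network *)

Section Network.
Variables (R : realType) (m : mesh R).

(* The edge (k = false) or the dual edge (k = true) of the diamond e. *)
Definition nd (e : edge m) (k o : bool) : node m :=
  if k then inr (ends e o) else inl (side e o).

Definition dl (u : node m -> R) (e : edge m) (k : bool) : R :=
  delta u (nd e k false) (nd e k true).

Variables (f : fluid R) (cA : node m -> R) (T : edge m -> bool -> R)
  (H : edge m -> R) (dt : R) (pn : phase -> node m -> R).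
Implicit Types (p : phase -> node m -> R) (a : phase) (eps eta : R).

(** The factor [(-1) ^+ o] reverses eta_D together with the edge, while the transverse edge always
    keeps its reference orientation. *)
Definition gflux eps eta p a e k o : R :=
  rho_mean f p a (nd e k o) (nd e k (~~ o)) *
  (Vflux f eps p a (T e k) ((-1) ^+ o * H e) (nd e k o) (nd e k (~~ o))
     (nd e (~~ k) false) (nd e (~~ k) true)
   + eta * (-1) ^+ deg a * pcflux p (T e k) (nd e k o) (nd e k (~~ o))).

Definition gacc p a A : R :=
  cA A * (rho f a (p a A) * trunc01 (sat f p a A) - rho f a (pn a A) * sat f pn a A).

Definition gscheme eps eta p a A : R :=
  gacc p a A - dt * \sum_e \sum_k \sum_(o | nd e k o == A) gflux eps eta p a e k o.

Hypotheses (hf : is_fluid f) (cA_ge0 : forall A, 0 <= cA A)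
  (T_gt0 : forall e k, 0 < T e k) (H_lt : forall e, H e ^+ 2 < T e false * T e true)
  (dt_gt0 : 0 < dt) (hsn : forall a A, 0 <= sat f pn a A <= 1)
  (nodes_ind : forall P : node m -> Prop, (forall A, dirichlet A -> P A) ->
    (forall e k, P (nd e k false) <-> P (nd e k true)) -> forall A, P A).

Lemma deltaN (u : node m -> R) A B : delta u B A = - delta u A B.
Proof. by rewrite /delta opprB. Qed.

Lemma rho_continuous a : continuous (rho f a).
Proof.
move=> x; apply: differentiable_continuous; apply/derivable1_diffP.
exact: (rho_derivable hf).
Qed.

Lemma rho_meanC p a A B : rho_mean f p a A B = rho_mean f p a B A.
Proof.
have [b0 [b1 [b00 rb]]] := rho_bounded hf.
by rewrite /rho_mean (@inv_rhoC R (rho f a) b0 b1 (@rho_continuous a) b00 (rb a)).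
Qed.

Lemma rho_mean_gt0 p a A B : 0 < rho_mean f p a A B.
Proof.
have [b0 [b1 [b00 rb]]] := rho_bounded hf.
rewrite /rho_mean invr_gt0.
exact: (@inv_rho_gt0 R (rho f a) b0 b1 (@rho_continuous a) (rho_incr hf a) b00 (rb a)).
Qed.

Definition G a : R -> R := density_potential (rho f a).

Lemma G0 a : G a 0 = 0. Proof. exact: density_potential0. Qed.

Lemma rho_mean_G p a A B : rho_mean f p a A B * delta (fun C => G a (p a C)) A B =
  delta (p a) A B.
Proof.
have [b0 [b1 [b00 rb]]] := rho_bounded hf.
rewrite /delta /G -(@inv_rho_potential R (rho f a) b0 b1 (@rho_continuous a) b00 (rb a)).
rewrite mulrA /rho_mean mulVf ?mul1r // -invr_eq0 gt_eqF //.
exact: rho_mean_gt0 p a A B.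
Qed.

Lemma G_sg a x : 0 <= x * G a x.
Proof.
have [b0 [b1 [b00 rb]]] := rho_bounded hf.
exact: (@density_potential_sg R (rho f a) b0 b1 (@rho_continuous a) (rho_incr hf a) b00 (rb a)).
Qed.

Lemma Meps_ge eps a u : 0 <= eps -> eps <= Meps f eps a u.
Proof. by move=> e0; rewrite lerDl (mobility_ge0 hf). Qed.

Lemma Meps_ge0 eps a u : 0 <= eps -> 0 <= Meps f eps a u.
Proof. by move=> e0; apply: le_trans (Meps_ge _ _ e0). Qed.

Lemma Mup_ge eps p a A B : 0 <= eps -> eps <= Mup f eps p a A B.
Proof. by move=> e0; rewrite /Mup; case: ifP => _; exact: Meps_ge. Qed.

Lemma Mup_ge0 eps p a A B : 0 <= eps -> 0 <= Mup f eps p a A B.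
Proof. by move=> e0; apply: le_trans (Mup_ge _ _ _ _ e0). Qed.

Lemma Mmin_Mup eps p a A B : Mmin f eps p a A B <= Mup f eps p a A B.
Proof. by rewrite /Mup /Mmin; case: ifP => _; rewrite ge_min lexx ?orbT. Qed.

(** When the pressures agree the two orientations select different upwind cells, so [Mup] alone is
    not symmetric; the increment then vanishes. *)
Lemma Mup_sym eps p a A B :
  Mup f eps p a B A * delta (p a) A B = Mup f eps p a A B * delta (p a) A B.
Proof.
rewrite /Mup (deltaN _ A B) oppr_ge0.
by case: (ltgtP (delta (p a) A B) 0) => [_|_|->] //; rewrite !mulr0.
Qed.

Lemma gflux_anti eps eta p a e k :
  gflux eps eta p a e k true = - gflux eps eta p a e k false.
Proof.
rewrite /gflux /= rho_meanC -mulrN; congr (_ * _).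
rewrite /Vflux /pcflux /= (deltaN (p a) (nd e k false)) mulrN mulrAC Mup_sym.
rewrite (deltaN _ (nd e k false)) [Mmin _ _ _ _ (nd e k true) _]minC.
rewrite -/(Mmin f eps p a (nd e k false) (nd e k true)) expr0 expr1.
ring.
Qed.

Lemma sum_by_parts eps eta p a (g : node m -> R) :
  \sum_A (\sum_e \sum_k \sum_(o | nd e k o == A) gflux eps eta p a e k o) * g A
  = - \sum_e \sum_k gflux eps eta p a e k false * dl g e k.
Proof.
transitivity (\sum_e \sum_k \sum_o gflux eps eta p a e k o * g (nd e k o)).
  transitivity (\sum_A \sum_e \sum_k \sum_(o | nd e k o == A)
      gflux eps eta p a e k o * g (nd e k o)).
    apply: eq_bigr => A _; rewrite mulr_suml; apply: eq_bigr => e _.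
    rewrite mulr_suml; apply: eq_bigr => k _; rewrite mulr_suml.
    by apply: eq_bigr => o /eqP ->.
  rewrite exchange_big; apply: eq_bigr => e _ /=.
  rewrite exchange_big; apply: eq_bigr => k _ /=.
  rewrite (exchange_big_dep xpredT) //=; apply: eq_bigr => o _.
  by rewrite (eq_bigl (pred1 (nd e k o))) ?big_pred1_eq // => A; rewrite /= eq_sym.
rewrite -sumrN; apply: eq_bigr => e _; rewrite -sumrN; apply: eq_bigr => k _.
by rewrite big_bool /= gflux_anti /dl /delta; ring.
Qed.

(** * A priori estimates *)

Definition cap p (A : node m) : R := p gas A - p water A.

Lemma dl_cap p e k : dl (cap p) e k = dl (p gas) e k - dl (p water) e k.
Proof. by rewrite /dl /delta /cap; ring. Qed.

Definition dissip eps p a : R :=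
  \sum_e \sum_k Mup f eps p a (nd e k false) (nd e k true) * dl (p a) e k ^+ 2.
Definition capen p : R := \sum_e \sum_k dl (cap p) e k ^+ 2.
Definition grad2 p : R :=
  \sum_e \sum_k (dl (p gas) e k ^+ 2 + dl (p water) e k ^+ 2).

Lemma finite_min (I : finType) (F : I -> R) : (forall i, 0 < F i) ->
  exists2 c, 0 < c & forall i, c <= F i.
Proof.
move=> F0; exists (\big[Num.min/1]_i F i).
  apply: (big_ind (fun x => 0 < x)) => // x y x0 y0; by rewrite lt_min x0.
by move=> i; rewrite (bigD1 i) //= ge_min lexx.
Qed.

Lemma diamond_coercive : exists2 c, 0 < c & forall e (x y : R),
  c * (x ^+ 2 + y ^+ 2) <=
  T e false * x ^+ 2 + T e true * y ^+ 2 - 2 * `|H e| * `|x| * `|y|.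
Proof.
(* Determinant over trace: a lower bound for the smallest eigenvalue of the quadratic form of the
   diamond. *)
pose F e := (T e false * T e true - H e ^+ 2) / (T e false + T e true).
have Fp e : 0 < F e by apply: divr_gt0; [rewrite subr_gt0|apply: addr_gt0].
have [c c0 cF] := finite_min Fp; exists c => // e x y.
have := cF e; rewrite /F ler_pdivlMr ?addr_gt0 // => cH.
have t0 := T_gt0 e false; have t1 := T_gt0 e true.
rewrite -(real_normK (num_real x)) -(real_normK (num_real y)).
have := cH; rewrite -(real_normK (num_real (H e))).
set u := `|x|; set v := `|y|; set h := `|H e|; set t := T e false; set s := T e true.
have u0 : 0 <= u := normr_ge0 _; have v0 : 0 <= v := normr_ge0 _; have h0 : 0 <= h := normr_ge0 _.
rewrite -/t in t0; rewrite -/s in t1 => {}cH.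
have ct : c < t.
  have : c * (t + s) < t * (t + s) by nra.
  by rewrite ltr_pM2r // addr_gt0.
rewrite -subr_ge0.
have -> : t * u ^+ 2 + s * v ^+ 2 - 2 * h * u * v - c * (u ^+ 2 + v ^+ 2) =
  (((t - c) * u - h * v) ^+ 2 + (t * s - c * (t + s) - h ^+ 2 + c ^+ 2) * v ^+ 2) / (t - c).
  by field; rewrite subr_eq0 gt_eqF.
rewrite divr_ge0 ?subr_ge0 ?(ltW ct) // addr_ge0 ?sqr_ge0 // mulr_ge0 ?sqr_ge0 //.
nra.
Qed.

Lemma dl_gflux eps eta p a e k :
  gflux eps eta p a e k false * dl (fun A => G a (p a A)) e k =
  dl (p a) e k * (Vflux f eps p a (T e k) (H e) (nd e k false) (nd e k true)
    (nd e (~~ k) false) (nd e (~~ k) true)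
    + eta * (-1) ^+ deg a * (T e k * dl (cap p) e k)).
Proof.
by rewrite /gflux mulrAC /dl rho_mean_G expr0 mul1r.
Qed.

(** Because [Mmin] is at most [Mup], both cross coefficients are bounded by the square root of the
    product of the two upwind mobilities. The diamond form is therefore coercive in the increments
    scaled by the square roots of those mobilities. *)
Lemma Vflux_coercive : exists2 c, 0 < c & forall eps p a, 0 <= eps ->
  c * dissip eps p a <= \sum_e \sum_k dl (p a) e k *
    Vflux f eps p a (T e k) (H e) (nd e k false) (nd e k true)
      (nd e (~~ k) false) (nd e (~~ k) true).
Proof.
have [c c0 cH] := diamond_coercive; exists c => // eps p a e0.
rewrite mulr_sumr; apply: ler_sum => e _; rewrite !big_bool /= /Vflux.
rewrite -/(dl (p a) e true) -/(dl (p a) e false).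
set x := dl (p a) e false; set y := dl (p a) e true.
set M := Mup f eps p a (nd e false false) (nd e false true).
set N := Mup f eps p a (nd e true false) (nd e true true).
set K := Mmin f eps p a (nd e false false) (nd e false true).
set L := Mmin f eps p a (nd e true false) (nd e true true).
have M0 : 0 <= M by exact: Mup_ge0. have N0 : 0 <= N by exact: Mup_ge0.
have KM : Num.sqrt K <= Num.sqrt M by rewrite ler_wsqrtr // Mmin_Mup.
have LN : Num.sqrt L <= Num.sqrt N by rewrite ler_wsqrtr // Mmin_Mup.
have := cH e (Num.sqrt M * x) (Num.sqrt N * y).
rewrite !exprMn !sqr_sqrtr // !normrM.
rewrite !(ger0_norm (sqrtr_ge0 _)).
have k0 := sqrtr_ge0 K; have l0 := sqrtr_ge0 L.
set k := Num.sqrt K in KM k0 *; set l := Num.sqrt L in LN l0 *.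
set s := Num.sqrt M in KM *; set t := Num.sqrt N in LN *.
have kt : k * t + l * s <= 2 * (s * t).
  have s0 : 0 <= s by apply: sqrtr_ge0. have t0 : 0 <= t by apply: sqrtr_ge0.
  have := ler_wpM2r t0 KM; have := ler_wpM2l s0 LN; lra.
have : - ((k * t + l * s) * H e * x * y) <= 2 * (s * t) * (`|H e| * `|x| * `|y|).
  have E : (k * t + l * s) * H e * x * y = (k * t + l * s) * (H e * x * y) by ring.
  apply: le_trans (ler_norm _) _; rewrite E normrN normrM.
  rewrite [`|k * t + _|]ger0_norm ?addr_ge0 ?mulr_ge0 ?sqrtr_ge0 //.
  by rewrite !(normrM _ y) (normrM _ x) ler_wpM2r // ?mulr_ge0.
lra.
Qed.

(** The weakest condition from which the bounds follow. Solutions satisfy it with equality; a point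
    on the face of a cube where the scheme points towards the origin satisfies it as well. *)
Definition admissible eps eta p : Prop :=
  (forall a, RTDir (p a)) /\
  \sum_A gscheme eps eta p gas A * G gas (p gas A) +
  \sum_A gscheme eps eta p water A * G water (p water A) <= 0.

Lemma finite_sup (I : finType) (F : I -> R) : exists2 C, 0 <= C & forall i, F i <= C.
Proof.
exists (\sum_i `|F i|) => [|i]; first by apply: sumr_ge0.
by rewrite (bigD1 i) //= ler_wpDr ?ler_norm // sumr_ge0.
Qed.

Lemma poincare : exists2 C, 0 <= C & forall (u : node m -> R) (d : R), 0 <= d -> RTDir u ->
  (forall e k, `|dl u e k| <= d) -> forall A, `|u A| <= C * d.
Proof.
(* The constant must be chosen before [u], so it is part of the predicate that is propagated; each
   edge crossed adds 1 to it. *)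
pose P A := exists2 C, 0 <= C & forall (u : node m -> R) (d : R), 0 <= d -> RTDir u ->
  (forall e k, `|dl u e k| <= d) -> `|u A| <= C * d.
have PA : forall A, P A.
  apply: nodes_ind => [A dA|e k].
    by exists 0 => // u d d0 /(_ A dA) -> _; rewrite normr0 mul0r.
  split=> -[C C0 CP]; exists (C + 1); rewrite ?addr_ge0 // => u d d0 ud ul;
    have := CP u d d0 ud ul; have := ul e k; rewrite /dl /delta mulrDl mul1r => h1 h2.
    have -> : u (nd e k true) = u (nd e k false) + (u (nd e k true) - u (nd e k false)) by ring.
    by apply: le_trans (ler_normD _ _) _; apply: lerD.
  have -> : u (nd e k false) = u (nd e k true) - (u (nd e k true) - u (nd e k false)) by ring.
  by apply: le_trans (ler_normB _ _) _; apply: lerD.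
have QA A : {C | 0 <= C & forall (u : node m -> R) (d : R), 0 <= d -> RTDir u ->
  (forall e k, `|dl u e k| <= d) -> `|u A| <= C * d} by apply: cid2; exact: PA.
have [C C0 CP] := finite_sup (fun A => let: exist2 C _ _ := QA A in C).
exists C => // u d d0 ud ul A; have := CP A; case: (QA A) => CA _ /(_ u d d0 ud ul).
by move=> /le_trans + CC; apply; apply: ler_wpM2r.
Qed.

(** Truncated saturations and bounded densities bound the accumulation independently of [p], and the
    potential grows at most linearly; [poincare] then replaces the pressures by their increments. *)
Lemma gacc_bound : exists2 K, 0 <= K & forall p a (d : R), 0 <= d -> RTDir (p a) ->
  (forall e k, `|dl (p a) e k| <= d) ->
  - \sum_A gacc p a A * G a (p a A) <= K * d.
Proof.
have [C C0 CP] := poincare; have [b0 [b1 [b00 rb]]] := rho_bounded hf.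
have b1_gt0 := density_ub_gt0 b00 (rb gas).
exists (\sum_A cA A * b1 * (b0^-1 * C)) => [|p a d d0 pa pd].
  by apply: sumr_ge0 => A _; rewrite !mulr_ge0 // ?invr_ge0 ltW.
rewrite -sumrN mulr_suml; apply: ler_sum => A _.
apply: le_trans (ler_norm _) _; rewrite normrN normrM -[leRHS]mulrA.
apply: ler_pM => //.
  rewrite /gacc normrM (ger0_norm (cA_ge0 A)); apply: ler_wpM2l => //.
  have B x y : b0 <= x <= b1 -> 0 <= y <= 1 -> 0 <= x * y <= b1.
    move=> /andP[x0 x1] /andP[y0 y1]; have x0' := le_trans (ltW b00) x0.
    by rewrite mulr_ge0 //= -[b1]mulr1 ler_pM.
  have z01 : 0 <= trunc01 (sat f p a A) <= 1.
    by rewrite /trunc01 le_min le_max lexx orbT ler01 ge_min lexx orbT.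
  have /andP[h1 h2] := B _ _ (rb a (p a A)) z01.
  have /andP[h3 h4] := B _ _ (rb a (pn a A)) (hsn a A).
  by rewrite ler_norml; apply/andP; split; lra.
have /le_trans := density_potential_bound (@rho_continuous a) (rho_incr hf a) b00 (rb a) (p a A).
apply; rewrite -mulrA ler_wpM2l ?invr_ge0 ?(ltW b00) //.
exact: CP.
Qed.

Lemma energy : exists2 K, 0 <= K & exists2 c, 0 < c &
  forall eps eta p (d : R), 0 <= eps -> 0 <= eta -> 0 <= d -> admissible eps eta p ->
  (forall a e k, `|dl (p a) e k| <= d) ->
  c * (dissip eps p gas + dissip eps p water) + c * eta * capen p <= K * d.
Proof.
have [K K0 HK] := gacc_bound; have [c1 c10 Hc1] := Vflux_coercive.
have [c2 c20 Hc2] := finite_min (fun ek : edge m * bool => T_gt0 ek.1 ek.2).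
(* One accumulation bound per phase. *)
exists (2 * K); first by rewrite mulr_ge0.
exists (dt * Num.min c1 c2); first by rewrite mulr_gt0 // lt_min c10.
move=> eps eta p d eps0 eta0 d0 [pD].
have S a : \sum_A gscheme eps eta p a A * G a (p a A) =
    \sum_A gacc p a A * G a (p a A) + dt * (\sum_e \sum_k dl (p a) e k *
    Vflux f eps p a (T e k) (H e) (nd e k false) (nd e k true)
      (nd e (~~ k) false) (nd e (~~ k) true) +
    eta * (-1) ^+ deg a * \sum_e \sum_k T e k * dl (cap p) e k * dl (p a) e k).
  transitivity (\sum_A gacc p a A * G a (p a A) - dt *
    \sum_A (\sum_e \sum_k \sum_(o | nd e k o == A) gflux eps eta p a e k o) * G a (p a A)).
    rewrite mulr_sumr -sumrB; apply: eq_bigr => A _; rewrite /gscheme; ring.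
  rewrite sum_by_parts mulrN opprK; congr (_ + dt * _).
  rewrite mulr_sumr -big_split; apply: eq_bigr => e _ /=.
  rewrite mulr_sumr -big_split; apply: eq_bigr => k _ /=.
  rewrite dl_gflux; ring.
rewrite !S /= => + pd; have := HK p gas d d0 (pD gas) (pd gas).
have := HK p water d d0 (pD water) (pd water).
have := Hc1 eps p gas eps0; have := Hc1 eps p water eps0.
set Vg := \sum_e _; set Vw := \sum_e _.
set Ag := \sum_A _; set Aw := \sum_A _.
set Cg := \sum_e _; set Cw := \sum_e _.
(* The signs of the eta-terms turn the sum over the phases into a difference, whose terms are the
   transmissibilities times the squared capillary increments. *)
have CE : c2 * capen p <= Cg - Cw.
  rewrite /capen mulr_sumr -sumrB; apply: ler_sum => e _.
  rewrite mulr_sumr -sumrB; apply: ler_sum => k _.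
  have := Hc2 (e, k); rewrite /= => /(ler_wpM2r (sqr_ge0 (dl (cap p) e k))) /le_trans; apply.
  by rewrite -mulrBr -dl_cap expr2 mulrA.
have cap0 : 0 <= capen p by apply: sumr_ge0 => e _; apply: sumr_ge0 => k _; exact: sqr_ge0.
have Dg a : 0 <= dissip eps p a.
  by apply: sumr_ge0 => e _; apply: sumr_ge0 => k _; rewrite mulr_ge0 ?sqr_ge0 ?Mup_ge0.
move=> hw hg hAw hAg hS.
have m1 : Num.min c1 c2 <= c1 by rewrite ge_min lexx.
have m2 : Num.min c1 c2 <= c2 by rewrite ge_min lexx orbT.
set c := Num.min c1 c2 in m1 m2 *.
have e1 := ler_wpM2r (Dg gas) m1; have e2 := ler_wpM2r (Dg water) m1.
have e3 := ler_wpM2l eta0 (le_trans (ler_wpM2r cap0 m2) CE).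
have e4 : c * (dissip eps p gas + dissip eps p water) + eta * (c * capen p)
  <= Vg + Vw + eta * (Cg - Cw) by lra.
have := ler_wpM2l (ltW dt_gt0) e4; rewrite expr0 expr1 in hS; lra.
Qed.

(** If the two pressure increments have the same sign, both phases are upwinded at the same cell,
    where one mobility is at least m0 / 2; the increment of the other phase is recovered from the
    capillary one. If the signs are opposite, the upwind cells may differ, but the capillary
    increment alone dominates both. *)
Lemma total_mobility : exists2 K, 0 <= K & forall eps p, 0 <= eps ->
  grad2 p <= K * (dissip eps p gas + dissip eps p water + capen p).
Proof.
have [m0 m00 hm0] := mobility_total hf.
exists (6 / m0 + 2) => [|eps p eps0]; first by rewrite addr_ge0 // divr_ge0 // ltW.
rewrite /dissip /capen -!big_split mulr_sumr /=; apply: ler_sum => e _.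
rewrite -!big_split mulr_sumr /=; apply: ler_sum => k _.
rewrite dl_cap /Mup -!/(dl _ e k).
set A := nd e k false; set B := nd e k true.
set x := dl _ e k; set y := dl _ e k.
have key C : x ^+ 2 + y ^+ 2 <= (6 / m0 + 2) * (Meps f eps gas (sat f p gas C) * x ^+ 2 +
    Meps f eps water (sat f p water C) * y ^+ 2 + (x - y) ^+ 2).
  have := hm0 (sat f p gas C); rewrite -[1 - sat f p gas C]/(sat f p water C).
  rewrite /Meps; set Mw := mobility f water _; set Mg := mobility f gas _ => M.
  have Mg0 : 0 <= Mg by exact: mobility_ge0. have Mw0 : 0 <= Mw by exact: mobility_ge0.
  have q0 : 0 <= 6 / m0 by rewrite divr_ge0 // ltW.
  (* Writing w = z - (z - w) gives z^2 + w^2 <= 3 z^2 + 2 (z - w)^2, and 3 <= (6 / m0) N. *)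
  have W (N z w : R) : m0 <= 2 * N -> z ^+ 2 + w ^+ 2 <= (6 / m0) * (N * z ^+ 2) + 2 * (z - w) ^+ 2.
    move=> HN; have hq : 3 <= 6 / m0 * N by rewrite mulrAC ler_pdivlMr //; lra.
    have := ler_wpM2r (sqr_ge0 z) hq; rewrite -[leRHS]mulrA.
    set q := 6 / m0 * _; have := sqr_ge0 (z + (z - w)); nra.
  have x0 := sqr_ge0 x; have y0 := sqr_ge0 y; have z0 := sqr_ge0 (x - y).
  have ex0 := mulr_ge0 eps0 x0; have ey0 := mulr_ge0 eps0 y0.
  have gx0 := mulr_ge0 Mg0 x0; have wy0 := mulr_ge0 Mw0 y0.
  have r1 := mulr_ge0 q0 ex0; have r2 := mulr_ge0 q0 ey0; have r3 := mulr_ge0 q0 gx0.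
  have r4 := mulr_ge0 q0 wy0; have r5 := mulr_ge0 q0 z0.
  have [h|h] := leP m0 (2 * Mg).
    have := W _ x y h; move: r1 r2 r3 r4 r5; set Q := 6 / m0; lra.
  have h' : m0 <= 2 * Mw by lra.
  have := W _ y x h'; rewrite -(sqrrN (y - x)) opprB.
  move: r1 r2 r3 r4 r5; set Q := 6 / m0; lra.
have key2 N M : 0 <= N -> 0 <= M -> x * y <= 0 -> x ^+ 2 + y ^+ 2 <= (6 / m0 + 2) *
   (N * x ^+ 2 + M * y ^+ 2 + (x - y) ^+ 2).
  move=> N0 M0 xy; have q0 : 0 <= 6 / m0 by rewrite divr_ge0 // ltW.
  have x0 := mulr_ge0 N0 (sqr_ge0 x); have y0 := mulr_ge0 M0 (sqr_ge0 y).
  have z0 := sqr_ge0 (x - y).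
  have := mulr_ge0 q0 (addr_ge0 (addr_ge0 x0 y0) z0).
  move=> h; have h2 : (x - y) ^+ 2 = x ^+ 2 + y ^+ 2 - 2 * (x * y) by ring.
  move: h; have := sqr_ge0 x; have := sqr_ge0 y; set Q := 6 / m0; lra.
rewrite -/x -/y.
case: (leP 0 x) => x0; case: (leP 0 y) => y0; try exact: key; apply: key2; try exact: Meps_ge0; nra.
Qed.

Lemma quadratic_bound (a b d : R) : 0 <= a -> 0 <= b -> 0 <= d ->
  d ^+ 2 <= a * d + b -> d <= a + b + 1.
Proof.
move=> a0 b0 d0 H1; case: (leP d 1) => d1; first by lra.
have : d * d <= (a + b) * d by rewrite -expr2; nra.
by rewrite ler_pM2r ?(lt_trans ltr01) // => ?; lra.
Qed.

Lemma grad2_dominates p a e k : `|dl (p a) e k| <= Num.sqrt (grad2 p).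
Proof.
rewrite -sqrtr_sqr ler_wsqrtr // /grad2 (bigD1 e) //= (bigD1 k) //=.
have S (P : pred (edge m)) (Q : edge m -> pred bool) : 0 <=
    \sum_(e | P e) \sum_(k | Q e k) (dl (p gas) e k ^+ 2 + dl (p water) e k ^+ 2).
  by apply: sumr_ge0 => *; apply: sumr_ge0 => *; rewrite addr_ge0 ?sqr_ge0.
have S1 (Q : pred bool) : 0 <= \sum_(k | Q k) (dl (p gas) e k ^+ 2 + dl (p water) e k ^+ 2).
  by apply: sumr_ge0 => *; rewrite addr_ge0 ?sqr_ge0.
have := S (fun i => i != e) (fun _ _ => true); have := S1 (fun i => i != k).
by case: a; have := sqr_ge0 (dl (p gas) e k); have := sqr_ge0 (dl (p water) e k); lra.
Qed.

(* P will be one of three regimes: eps fixed, eta fixed, or bounded capillary energy. *)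
Lemma a_priori (P : R -> R -> (phase -> node m -> R) -> Prop) :
  (forall eps eta p, P eps eta p -> [/\ 0 <= eps, 0 <= eta & admissible eps eta p]) ->
  (forall K c : R, 0 <= K -> 0 < c -> exists b1 b2 : R, [/\ 0 <= b1, 0 <= b2 &
   forall eps eta p (d : R), P eps eta p -> 0 <= d -> d ^+ 2 = grad2 p ->
     c * (dissip eps p gas + dissip eps p water) + c * eta * capen p <= K * d ->
     grad2 p <= b1 * d + b2]) ->
  exists r, forall eps eta p, P eps eta p -> forall a A, `|p a A| <= (r : R).
Proof.
move=> Pa HP; have [K K0 [c c0 En]] := energy.
have [a1 [b1 [a10 b10 HP1]]] := HP K c K0 c0; have [C C0 CP] := poincare.
exists (C * (a1 + b1 + 1)) => eps eta p Pp ph A.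
have [eps0 eta0 pa] := Pa _ _ _ Pp; pose d := Num.sqrt (grad2 p).
have d0 : 0 <= d by exact: sqrtr_ge0.
have g0 : 0 <= grad2 p.
  by apply: sumr_ge0 => *; apply: sumr_ge0 => *; rewrite addr_ge0 ?sqr_ge0.
have d2 : d ^+ 2 = grad2 p by rewrite sqr_sqrtr.
have E := En eps eta p d eps0 eta0 d0 pa (grad2_dominates p).
have := HP1 eps eta p d Pp d0 d2 E; rewrite -d2 => /(quadratic_bound a10 b10 d0) dl_.
have /le_trans := CP (p ph) d d0 (pa.1 ph) (grad2_dominates p ph) A; apply.
exact: ler_wpM2l.
Qed.

Lemma dissip_ge0 eps p a : 0 <= eps -> 0 <= dissip eps p a.
Proof.
by move=> eps0; apply: sumr_ge0 => e _; apply: sumr_ge0 => k _; rewrite mulr_ge0 ?sqr_ge0 ?Mup_ge0.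
Qed.

Lemma capen_ge0 p : 0 <= capen p.
Proof. by apply: sumr_ge0 => e _; apply: sumr_ge0 => k _; exact: sqr_ge0. Qed.

Lemma bounded_eps eps : 0 < eps -> exists r : R, forall eta p, 0 <= eta ->
  admissible eps eta p -> forall a A, `|p a A| <= r.
Proof.
move=> eps0; pose P e eta p := [/\ e = eps, 0 <= eta & admissible eps eta p].
have [|K c K0 c0|r hr] := @a_priori P; last by exists r => eta p eta0 ap; apply: (hr eps eta).
  by move=> _ eta p [-> eta0 ap]; split => //; exact: ltW.
exists (K / (c * eps)), 0; split => //; first by rewrite divr_ge0 ?mulr_ge0 // ltW.
move=> _ eta p d [-> eta0 _] d0 _ E; rewrite addr0 mulrAC ler_pdivlMr ?mulr_gt0 //.
apply: le_trans E; rewrite ler_wpDr ?mulr_ge0 ?capen_ge0 ?(ltW c0) //.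
rewrite mulrC -mulrA ler_pM2l // /grad2 /dissip -big_split mulr_sumr /=.
apply: ler_sum => e _; rewrite -big_split mulr_sumr /=; apply: ler_sum => k _.
by rewrite mulrDr lerD // ler_wpM2r ?sqr_ge0 // Mup_ge // ltW.
Qed.

Lemma bounded_eta eta : 0 < eta -> exists r : R, forall eps p, 0 <= eps ->
  admissible eps eta p -> forall a A, `|p a A| <= r.
Proof.
move=> eta0; have [K1 K10 HK1] := total_mobility.
pose P eps e p := [/\ e = eta, 0 <= eps & admissible eps eta p].
have [|K c K0 c0|r hr] := @a_priori P; last by exists r => eps p eps0 ap; apply: (hr eps eta).
  by move=> eps _ p [-> eps0 ap]; split => //; exact: ltW.
exists (K1 * (K / c + K / (c * eta))), 0; split => //.
  by rewrite mulr_ge0 // addr_ge0 // divr_ge0 ?mulr_ge0 // ltW.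
move=> eps _ p d [-> eps0 _] d0 _ E; have D0 := addr_ge0 (dissip_ge0 p gas eps0) (dissip_ge0 p water eps0).
have C0 := capen_ge0 p; apply: le_trans (HK1 _ p eps0) _; rewrite addr0 -mulrA ler_wpM2l //.
rewrite mulrDl lerD // mulrAC ler_pdivlMr ?mulr_gt0 // mulrC; apply: le_trans E.
  by rewrite ler_wpDr // mulr_ge0 // mulr_ge0 // ltW.
by rewrite ler_wpDl // mulr_ge0 // ltW.
Qed.

Lemma bounded_capen (M : R) : 0 <= M -> exists r : R, forall eps eta p, 0 <= eps -> 0 <= eta ->
  capen p <= M -> admissible eps eta p -> forall a A, `|p a A| <= r.
Proof.
move=> M0; have [K1 K10 HK1] := total_mobility.
pose P eps eta p := [/\ 0 <= eps, 0 <= eta, capen p <= M & admissible eps eta p].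
have [|K c K0 c0|r hr] := @a_priori P; last by exists r => eps eta p *; apply: (hr eps eta).
  by move=> eps eta p [].
exists (K1 * (K / c)), (K1 * M); split; [by apply: mulr_ge0 => //; apply: divr_ge0 => //; exact: ltW|exact: mulr_ge0|].
move=> eps eta p d [eps0 eta0 cM _] d0 _ E.
apply: le_trans (HK1 _ p eps0) _; rewrite -[K1 * _ * d]mulrA -mulrDr ler_wpM2l // lerD //.
rewrite mulrAC ler_pdivlMr // mulrC; apply: le_trans E.
by rewrite ler_wpDr // !mulr_ge0 ?capen_ge0 // ltW.
Qed.

Definition gsolves eps eta p : Prop :=
  (forall a, RTDir (p a)) /\
  forall a A, ~ dirichlet A -> gscheme eps eta p a A = 0.

Lemma gsolves_admissible eps eta p : gsolves eps eta p -> admissible eps eta p.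
Proof.
move=> [pD ps]; split => //.
have Z a : \sum_A gscheme eps eta p a A * G a (p a A) = 0.
  apply: big1 => A _; have [dA|ndA] := pselect (dirichlet A).
    by rewrite (pD a A dA) G0 mulr0.
  by rewrite ps // mul0r.
by rewrite !Z addr0.
Qed.

(** * Maximum principle *)

Lemma pcinv_nd x y : (pcinv f x <= pcinv f y) = (x <= y).
Proof.
apply/idP/idP => [|xy].
  rewrite le_eqVlt => /orP[/eqP /(can_inj (pcinvK hf)) -> //|].
  by move=> /(pc_incr hf); rewrite !(pcinvK hf) => /ltW.
rewrite leNgt; apply/negP => /(pc_incr hf); rewrite !(pcinvK hf).
by rewrite ltNge xy.
Qed.

Lemma pcinv0 : pcinv f 0 = 0.
Proof. by rewrite -[in LHS](pc0 hf) (pcK hf). Qed.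

Lemma sat_le p a A B : sat f p a A <= sat f p a B ->
  0 <= (-1) ^+ deg a * delta (cap p) A B.
Proof.
rewrite /delta /cap; case: a => /=; rewrite ?lerD2l ?lerN2 pcinv_nd => h.
  by rewrite expr0 mul1r subr_ge0.
by rewrite expr1 mulN1r opprB subr_ge0.
Qed.

Lemma sat_eq p a A B : delta (cap p) A B = 0 -> sat f p a A = sat f p a B.
Proof. by move=> /subr0_eq; rewrite /cap /sat => ->. Qed.

(* At a cell where the saturation is minimal and negative the mobility vanishes, so that every
   flux has a sign; they must all vanish, and the minimum propagates to the neighbours. *)
Lemma sat_ge0 eta p : 0 < eta -> gsolves 0 eta p -> forall a A, 0 <= sat f p a A.
Proof.
move=> eta0 [pD ps] a A0; rewrite leNgt; apply/negP => neg.
have [A1 _ A1min] := arg_minP (fun A => sat f p a A) (isT : xpredT A0).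
have A1neg : sat f p a A1 < 0 by apply: le_lt_trans neg; exact: A1min.
have [mu mu_lt0 mumin] : exists2 mu, mu < 0 & sat f p a A1 = mu /\ forall A, mu <= sat f p a A.
  by exists (sat f p a A1) => //; split => // A; exact: A1min.
have satD A : dirichlet A -> 0 <= sat f p a A.
  move=> dA; rewrite /sat (pD gas A dA) (pD water A dA) subrr pcinv0.
  by case: (a); rewrite ?subr0.
case: mumin => A1mu mumin.
(* The induction over nodes shows that the negative minimum [mu] is attained nowhere. At Dirichlet
   nodes the saturation is 0 or 1; elsewhere attainment would spread across every edge in both
   directions. *)
suff : sat f p a A1 <> mu by [].
move: A1 {A1min A1neg A1mu}; apply: nodes_ind => [A /satD dA Amu|e k].
  by move: dA; rewrite Amu leNgt mu_lt0.
suff step o : sat f p a (nd e k o) = mu -> sat f p a (nd e k (~~ o)) = mu.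
  by split=> + E; apply; [exact: (step true)|exact: (step false)].
move=> Amu; rewrite -Amu; apply/esym/sat_eq.
have ndA : ~ dirichlet (nd e k o) by move=> /satD; rewrite Amu leNgt mu_lt0.
have M0 : Meps f 0 a (sat f p a (nd e k o)) = 0.
  by rewrite /Meps add0r (mobility_le0 hf) // Amu ltW.
pose pcterm e' k' o' := eta * (-1) ^+ deg a * pcflux p (T e' k') (nd e' k' o') (nd e' k' (~~ o')).
have pcterm_ge0 e' k' o' : nd e' k' o' = nd e k o -> 0 <= pcterm e' k' o'.
  move=> E; rewrite /pcterm /pcflux mulrACA; apply: mulr_ge0; first by rewrite mulr_ge0 // ltW.
  by apply: sat_le; rewrite E Amu.
have Vge0 e' k' o' : nd e' k' o' = nd e k o -> 0 <= Vflux f 0 p a (T e' k')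
    ((-1) ^+ o' * H e') (nd e' k' o') (nd e' k' (~~ o'))
    (nd e' (~~ k') false) (nd e' (~~ k') true).
  move=> E; rewrite /Vflux.
  (* The transverse term has no sign; it disappears because its weight is the minimum of the two
     mobilities. The other term survives only if the neighbour is upwind, and then its increment is
     nonnegative. *)
  have -> : Mmin f 0 p a (nd e' k' o') (nd e' k' (~~ o')) = 0.
    by rewrite /Mmin E M0 min_l // Meps_ge0.
  rewrite sqrtr0 !mul0r addr0 /Mup E M0; case: ifP => [d0|_]; last by rewrite !mul0r.
  by rewrite !mulr_ge0 ?Meps_ge0 // ltW.
have flux_ge0 e' k' o' : nd e' k' o' = nd e k o -> 0 <= gflux 0 eta p a e' k' o'.
  move=> E; rewrite /gflux mulr_ge0 ?(ltW (rho_mean_gt0 _ _ _ _)) //.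
  by rewrite addr_ge0 ?Vge0 //; exact: pcterm_ge0.
have flux_le : gflux 0 eta p a e k o <=
    \sum_e' \sum_k' \sum_(o' | nd e' k' o' == nd e k o) gflux 0 eta p a e' k' o'.
  have S e' k' : 0 <= \sum_(o' | nd e' k' o' == nd e k o) gflux 0 eta p a e' k' o'.
    by apply: sumr_ge0 => o' /eqP; exact: flux_ge0.
  rewrite (bigD1 e) //=; apply: ler_wpDr; first by do 2 apply: sumr_ge0 => ? _.
  rewrite (bigD1 k) //=; apply: ler_wpDr; first by apply: sumr_ge0 => ? _.
  rewrite (bigD1 o) //=; apply: ler_wpDr => //.
  by apply: sumr_ge0 => o' /andP[/eqP + _]; exact: flux_ge0.
have acc_le0 : gacc p a (nd e k o) <= 0.
  have [b0 [b1 [b00 rb]]] := rho_bounded hf.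
  have /andP[r0 _] := rb a (pn a (nd e k o)); have /andP[s0 _] := hsn a (nd e k o).
  rewrite /gacc /trunc01 Amu max_r ?(ltW mu_lt0) // min_l ?ler01 // mulr0 sub0r mulrN oppr_le0.
  by rewrite mulr_ge0 // mulr_ge0 // (le_trans (ltW b00)).
have flux0 : gflux 0 eta p a e k o = 0.
  apply/eqP; rewrite eq_le flux_ge0 // andbT; apply: le_trans flux_le _.
  have := ps a _ ndA; rewrite /gscheme => /eqP; rewrite subr_eq0 => /eqP E.
  by rewrite -(pmulr_rle0 _ dt_gt0) -E.
have /eqP := flux0; rewrite /gflux mulf_eq0 gt_eqF ?rho_mean_gt0 //= => /eqP.
rewrite -/(pcterm e k o) => Z.
(* A vanishing [Vflux] would tell nothing about the neighbour, whereas the eta-term vanishes only if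
   the two capillary pressures agree. *)
have /eqP : pcterm e k o = 0.
  by have := Vge0 e k o erefl; have := pcterm_ge0 e k o erefl; lra.
rewrite /pcterm /pcflux mulf_eq0 mulf_eq0 signr_eq0 (gt_eqF eta0) /= mulf_eq0 (gt_eqF (T_gt0 _ _)) /=.
by move/eqP.
Qed.

Lemma capen_bounded : exists2 M : R, 0 <= M & forall eta p, 0 < eta -> gsolves 0 eta p ->
  capen p <= M.
Proof.
pose b := pc f 1; exists (\sum_(e : edge m) \sum_(k : bool) b ^+ 2) => [|eta p eta0 ps].
  by apply: sumr_ge0 => *; apply: sumr_ge0 => *; rewrite sqr_ge0.
have cap01 A : 0 <= cap p A <= b.
  have := sat_ge0 eta0 ps gas A; have := sat_ge0 eta0 ps water A.
  by rewrite /sat -/(cap p A) subr_ge0 -!(pcinv_nd _ (cap p A)) -(pcinv_nd (cap p A)) pcinv0 (pcK hf) => -> ->.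
apply: ler_sum => e _; apply: ler_sum => k _; rewrite /dl /delta.
have /andP[h1 h2] := cap01 (nd e k false); have /andP[h3 h4] := cap01 (nd e k true).
rewrite -[leLHS]real_normK ?num_real // lerXn2r ?nnegrE //; first exact: le_trans h2.
by rewrite ler_norml; apply/andP; split; lra.
Qed.

End Network.

(** * Existence for the network *)

Section Continuity.
Variables (R : realType) (m : mesh R) (f : fluid R) (cA : node m -> R)
  (T : edge m -> bool -> R) (H : edge m -> R) (dt : R) (pn : phase -> node m -> R).
Hypothesis hf : is_fluid f.
Variables (X : topologicalType) (P : X -> phase -> node m -> R) (E N : X -> R).
Hypotheses (Pc : forall a A, continuous (fun x => P x a A)) (Ec : continuous E)
  (Nc : continuous N).

Lemma sat_continuous a A : continuous (fun x => sat f (P x) a A).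
Proof.
have C : continuous (fun x => pcinv f (P x gas A - P x water A)).
  move=> x; apply: (continuous_comp (f := fun x => P x gas A - P x water A)).
    by apply: cvgB; exact: Pc.
  exact: (pcinv_continuous hf).
case: a => //= x; rewrite /sat; apply: cvgB; [exact: cvg_cst|exact: C].
Qed.

Lemma Meps_continuous a A : continuous (fun x => Meps f (E x) a (sat f (P x) a A)).
Proof.
move=> x; apply: cvgD; first exact: Ec.
apply: (continuous_comp (sat_continuous (a := a) (A := A) (x := x))).
exact: (mobility_continuous hf).
Qed.

Lemma delta_continuous a A B : continuous (fun x => delta (P x a) A B).
Proof. by move=> x; apply: cvgB; exact: Pc. Qed.

Lemma Mmin_continuous a A B : continuous (fun x => Mmin f (E x) (P x) a A B).
Proof.
move=> x; apply: (@continuous_min R X (fun x => Meps f (E x) a (sat f (P x) a A))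
  (fun x => Meps f (E x) a (sat f (P x) a B)) x); exact: Meps_continuous.
Qed.

(* The upwind mobility jumps exactly where the pressure difference vanishes. *)
Lemma Mup_delta_continuous (g : R -> R) a A B : continuous g ->
  continuous (fun x => g (Mup f (E x) (P x) a A B) * delta (P x a) A B).
Proof.
move=> gc; have -> : (fun x => g (Mup f (E x) (P x) a A B) * delta (P x a) A B) =
   (fun x => g (Meps f (E x) a (sat f (P x) a B)) * Num.max (delta (P x a) A B) 0 +
     g (Meps f (E x) a (sat f (P x) a A)) * Num.min (delta (P x a) A B) 0).
  apply/funext => x; rewrite /Mup; case: (leP 0 (delta (P x a) A B)) => d0.
    by rewrite mulr0 addr0.
  by rewrite mulr0 add0r.
have C D x : {for x, continuous (fun x => g (Meps f (E x) a (sat f (P x) a D)))}.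
  exact: (continuous_comp (Meps_continuous (a := a) (A := D) (x := x)) (gc _)).
have Z x : {for x, continuous (cst 0 : X -> R)} by exact: cvg_cst.
move=> x; apply: cvgD; apply: cvgM; try exact: C.
  exact: (continuous_max (@delta_continuous a A B x) (Z x)).
exact: (continuous_min (@delta_continuous a A B x) (Z x)).
Qed.

Lemma rho_mean_continuous a A B : continuous (fun x => rho_mean f (P x) a A B).
Proof.
have [b0 [b1 [b00 rb]]] := rho_bounded hf; move=> x; apply: cvgV.
  rewrite gt_eqF //.
  exact: (inv_rho_gt0 (@rho_continuous R f hf a) (rho_incr hf a) b00 (rb a)).
exact: (inv_rho_continuous (@rho_continuous R f hf a) (rho_incr hf a) b00 (rb a)
  (Pc (a := a) (A := A)) (Pc (a := a) (A := B))).
Qed.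

Lemma Vflux_continuous a t h A B C D :
  continuous (fun x => Vflux f (E x) (P x) a t h A B C D).
Proof.
have -> : (fun x => Vflux f (E x) (P x) a t h A B C D) = (fun x =>
    t * (Mup f (E x) (P x) a A B * delta (P x a) A B) +
    h * Num.sqrt (Mmin f (E x) (P x) a A B) *
      (Num.sqrt (Mup f (E x) (P x) a C D) * delta (P x a) C D)).
  by apply/funext => x; rewrite /Vflux; ring.
move=> x; apply: cvgD; apply: cvgM.
- exact: cvg_cst.
- by apply: (@Mup_delta_continuous id) => ?; exact: cvg_id.
- apply: cvgM; first exact: cvg_cst.
  exact: (continuous_comp (@Mmin_continuous a A B x) (@sqrt_continuous R _)).
- apply: Mup_delta_continuous; exact: sqrt_continuous.
Qed.

Lemma gflux_continuous a e k o :
  continuous (fun x => gflux f T H (E x) (N x) (P x) a e k o).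
Proof.
move=> x; apply: cvgM; first exact: rho_mean_continuous.
apply: cvgD; first exact: Vflux_continuous.
apply: cvgM; first by apply: cvgM; [exact: Nc|exact: cvg_cst].
apply: cvgM; first exact: cvg_cst.
by apply: cvgB; apply: cvgB; exact: Pc.
Qed.

Lemma gacc_continuous a A : continuous (fun x => gacc f cA pn (P x) a A).
Proof.
move=> x; apply: cvgM; first exact: cvg_cst.
apply: cvgB; last exact: cvg_cst.
apply: cvgM; first exact: (continuous_comp (@Pc a A x) (@rho_continuous R f hf a _)).
have Z (c : R) : {for x, continuous (cst c : X -> R)} by exact: cvg_cst.
exact: (continuous_min (continuous_max (@sat_continuous a A x) (Z 0)) (Z 1)).
Qed.

Lemma gscheme_continuous a A :
  continuous (fun x => gscheme f cA T H dt pn (E x) (N x) (P x) a A).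
Proof.
have sumc (I : finType) (Q : pred I) (F : I -> X -> R) : (forall i, continuous (F i)) ->
    continuous (fun x => \sum_(i | Q i) F i x).
  by move=> Fc; apply: continuous_big => //; exact: add_continuous.
move=> x; apply: cvgB; first exact: gacc_continuous.
apply: cvgM; first exact: cvg_cst.
apply: (sumc _ _ (fun e y => \sum_k \sum_(o | nd e k o == A) gflux f T H (E y) (N y) (P y) a e k o)) => e.
apply: (sumc _ _ (fun k y => \sum_(o | nd e k o == A) gflux f T H (E y) (N y) (P y) a e k o)) => k.
apply: (sumc _ _ (fun o y => gflux f T H (E y) (N y) (P y) a e k o)) => o; exact: gflux_continuous.
Qed.

End Continuity.

(** * Solutions for positive eps, and passage to the limit *)

Section Existence.
Variables (R : realType) (m : mesh R) (f : fluid R) (cA : node m -> R)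
  (T : edge m -> bool -> R) (H : edge m -> R) (dt : R) (pn : phase -> node m -> R).
Hypotheses (hf : is_fluid f) (cA_ge0 : forall A, 0 <= cA A)
  (T_gt0 : forall e k, 0 < T e k) (H_lt : forall e, H e ^+ 2 < T e false * T e true)
  (dt_gt0 : 0 < dt) (hsn : forall a A, 0 <= sat f pn a A <= 1)
  (nodes_ind : forall P : node m -> Prop, (forall A, dirichlet A -> P A) ->
    (forall e k, P (nd e k false) <-> P (nd e k true)) -> forall A, P A).

Notation gscheme := (gscheme f cA T H dt pn).
Notation gsolves := (gsolves f cA T H dt pn).
Notation admissible := (admissible f cA T H dt pn).
Notation n := #|{: bool * node m}|.

Let phase_of (b : bool) : phase := if b then water else gas.
Let pidx (a : phase) (A : node m) : 'I_n := enum_rank (if a is water then true else false, A).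
Let unvec (x : 'rV[R]_n) (a : phase) (A : node m) : R := x 0 (pidx a A).

Let unvec_continuous a A : continuous (fun x => unvec x a A).
Proof. exact: coord_continuous. Qed.

(** At a Dirichlet node the residual is the unknown itself, so one complementarity problem over all
    nodes also enforces the boundary values. *)
Let residual eps eta (p : phase -> node m -> R) a A : R :=
  if `[< dirichlet A >] then p a A else gscheme eps eta p a A.

Let residual_continuous (X : topologicalType) (P : X -> phase -> node m -> R) (E N : X -> R) a A :
  (forall a A, continuous (fun x => P x a A)) -> continuous E -> continuous N ->
  continuous (fun x => residual (E x) (N x) (P x) a A).
Proof.
by move=> Pc Ec Nc; rewrite /residual; case: asboolP => _; [exact: Pc|exact: gscheme_continuous].
Qed.

Let residual0 eps eta p : (forall a A, residual eps eta p a A = 0) <-> gsolves eps eta p.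
Proof.
rewrite /residual; split=> [r0|[pD ps] a A].
  by split=> a A dA; have := r0 a A; case: asboolP.
by case: asboolP => [/(pD a)//|/ps].
Qed.

(** On a face of the cube the residual and the pressure have opposite signs, and [G] has the sign of
    the pressure, so each product in the tested sum is at most 0 and the point is admissible. The
    cube exceeds the bound of [bounded_eps], hence no face is reached. *)
Lemma gsolves_eps eps eta : 0 < eps -> 0 <= eta -> exists p, gsolves eps eta p.
Proof.
move=> eps0 eta0.
have [r0 hr0] := bounded_eps hf cA_ge0 T_gt0 H_lt dt_gt0 hsn nodes_ind eps0.
pose r := `|r0| + 1; have r_gt0 : 0 < r by rewrite ltr_wpDl.
pose F (x : 'rV[R]_n) (i : 'I_n) : R :=
  residual eps eta (unvec x) (phase_of (enum_val i).1) (enum_val i).2.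
have [|x xr xF] := cube_complementarity (F := F) r_gt0.
  by move=> i; apply: residual_continuous => //; exact: cst_continuous.
have {}xF a A : [\/ residual eps eta (unvec x) a A = 0,
    unvec x a A = r /\ residual eps eta (unvec x) a A <= 0 |
    unvec x a A = - r /\ 0 <= residual eps eta (unvec x) a A].
  by have := xF (pidx a A); rewrite /F /unvec /pidx enum_rankK /=; case: a.
have xD a : RTDir (unvec x a).
  move=> A dA; have := xF a A; rewrite /residual; case: asboolP => // _.
  by case=> [//|[-> ]|[-> ]]; lra.
have adm : admissible eps eta (unvec x).
  split=> //; have S a : \sum_A gscheme eps eta (unvec x) a A * G f a (unvec x a A) <= 0.
    apply: sumr_le0 => A _; have [dA|ndA] := pselect (dirichlet A).
      by rewrite (xD a A dA) G0 mulr0.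
    have := xF a A; rewrite /residual; case: asboolP => // _.
    case=> [->|[-> ?]|[-> ?]]; first by rewrite mul0r.
      apply: mulr_le0_ge0 => //; have := G_sg hf a r; by rewrite pmulr_rge0.
    apply: mulr_ge0_le0 => //; have := G_sg hf a (- r).
    by rewrite mulNr oppr_ge0 pmulr_rle0.
  by have := S gas; have := S water; lra.
exists (unvec x); apply/residual0 => a A.
have := hr0 _ _ eta0 adm a A => /le_lt_trans /(_ (_ : _ < r)) b.
have {}b : `|unvec x a A| < r.
  by apply: b; apply: le_lt_trans (ler_norm _) _; rewrite ltrDl.
by case: (xF a A) => [//|[E _]|[E _]]; move: b; rewrite E ?normrN gtr0_norm // ltxx.
Qed.

(** Pairs of a parameter in [0, 1] and a bounded solution form a compact set. Its projection to the
    parameters is closed and contains arbitrarily small positive ones, hence 0. *)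
Lemma gsolves_limit (E N : R -> R) (r : R) : continuous E -> continuous N ->
  (forall h, 0 < h -> exists2 p, gsolves (E h) (N h) p & forall a A, `|p a A| <= r) ->
  exists p, gsolves (E 0) (N 0) p.
Proof.
move=> Ec Nc hsol.
pose box := [set v : 'rV[R]_n | forall i, v 0 i \in `[- r, r]].
have cbox : compact box.
  by apply: (@rV_compact _ _ (fun=> `[- r, r]%classic)) => i; exact: segment_compact.
pose F (i : 'I_n) (z : R * 'rV[R]_n) : R :=
  residual (E z.1) (N z.1) (unvec z.2) (phase_of (enum_val i).1) (enum_val i).2.
have Fc i : continuous (F i).
  apply: residual_continuous => [a A z|z|z].
  - exact: (continuous_comp (f := snd) (@cvg_snd _ _ _ _ _) (@unvec_continuous a A _)).
  - exact: (continuous_comp (f := fst) (@cvg_fst _ _ _ _ _) (Ec _)).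
  - exact: (continuous_comp (f := fst) (@cvg_fst _ _ _ _ _) (Nc _)).
have FP z : (forall i, F i z = 0) <-> gsolves (E z.1) (N z.1) (unvec z.2).
  rewrite -residual0; split=> [Fz a A|H0 i]; last exact: H0.
  by have := Fz (pidx a A); rewrite /F /pidx enum_rankK; case: a.
pose Z := [set z : R * 'rV[R]_n | (`[0, 1] `*` box) z] `&` \bigcap_i (F i @^-1` [set 0]).
have cZ : compact Z.
  apply: compact_closedI; first by apply: compact_setX => //; exact: segment_compact.
  apply: closed_bigI => i _.
  have := (continuous_closedP (F i)).1 (Fc i) [set 0]; apply.
  exact: closed_eq.
have /compact_closed-/(_ (@Rhausdorff R)) cl : compact (fst @` Z).
  by apply: continuous_compact => //; apply: continuous_subspaceT => z; exact: cvg_fst.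
have : (fst @` Z) 0.
  apply: cl => B /nbhs_ballP[e /= e0 eB].
  pose h := Num.min 1 (e / 2); have h0 : 0 < h by rewrite lt_min ltr01 divr_gt0.
  have [p ps pr] := hsol h h0.
  exists h; split; last first.
    apply: eB; rewrite /ball /= sub0r normrN gtr0_norm // /h gt_min; apply/orP; right.
    by rewrite ltr_pdivrMr // ltr_pMr // ltr1n.
  pose x : 'rV[R]_n := \row_i p (phase_of (enum_val i).1) (enum_val i).2.
  have xp : unvec x = p.
    by apply/funext => a; apply/funext => A; rewrite /unvec /pidx mxE enum_rankK; case: a.
  exists (h, x) => //; split; first split => /=.
  - by rewrite in_itv /= (ltW h0) ge_min lexx.
  - by move=> i; rewrite mxE in_itv /= -ler_norml.
  - by move=> i _ /=; move: i; apply/FP; rewrite xp.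
move=> [[h x] [_ Zx] /= h0]; subst h; exists (unvec x).
by apply/(FP (0, x)) => i; exact: Zx.
Qed.

Theorem gsolves_exists : exists p, gsolves 0 0 p.
Proof.
have sol eta : 0 < eta -> exists p, gsolves 0 eta p.
  move=> eta0.
  have [r hr] := bounded_eta hf cA_ge0 T_gt0 H_lt dt_gt0 hsn nodes_ind eta0.
  apply: (@gsolves_limit id (cst eta) r) => [x|x|h h0]; [exact: cvg_id|exact: cvg_cst|].
  have [p ps] := gsolves_eps h0 (ltW eta0); exists p => //.
  by apply: (hr h) (ltW h0) _; exact: gsolves_admissible.
have [M M0 hM] := capen_bounded H hf cA_ge0 T_gt0 dt_gt0 hsn nodes_ind.
have [r hr] := bounded_capen hf cA_ge0 T_gt0 H_lt dt_gt0 hsn nodes_ind M0.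
apply: (@gsolves_limit (cst 0) id r) => [x|x|h h0]; [exact: cvg_cst|exact: cvg_id|].
have [p ps] := sol h h0; exists p => //.
apply: (hr 0 h) => //; [exact: ltW|exact: (hM h)|exact: gsolves_admissible].
Qed.

End Existence.

(** * Plane topology *)

Section PlaneTopology.
Variable R : realType.
Implicit Types (a b x y : R * R) (B S : set (R * R)).

Lemma closed_finite_exists (T : topologicalType) (I : finType) (F : I -> set T) :
  (forall i, closed (F i)) -> closed [set x | exists i, F i x].
Proof.
move=> Fc; have -> : [set x | exists i, F i x] = \bigcup_i F i.
  by apply/seteqP; split => x [i]; exists i.
by apply: closed_bigcup => //; exact: finite_finset.
Qed.

Lemma pt_on_continuous a b : continuous (pt_on a b).
Proof.
move=> t; have C (u v : R) : (fun t => (1 - t) * u + t * v) @ t --> (1 - t) * u + t * v.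
  apply: cvgD; apply: cvgM; try exact: cvg_cst; try exact: cvg_id.
  by apply: cvgB; [exact: cvg_cst|exact: cvg_id].
exact: (cvg_pair (C a.1 b.1) (C a.2 b.2)).
Qed.

Lemma pt_on0 a b : pt_on a b 0 = a.
Proof. by case: a b => a1 a2 [b1 b2]; rewrite /pt_on /=; congr pair; ring. Qed.

Lemma pt_on1 a b : pt_on a b 1 = b.
Proof. by case: a b => a1 a2 [b1 b2]; rewrite /pt_on /=; congr pair; ring. Qed.

Lemma pt_on_fst a b t u : pt_on a b t = pt_on a b u -> a != b -> t = u.
Proof.
case: a b => a1 a2 [b1 b2] [] /= e1 e2 ab; apply/eqP; rewrite -subr_eq0; apply/eqP.
have f1 : (t - u) * (b1 - a1) = 0 by lra.
have f2 : (t - u) * (b2 - a2) = 0 by lra.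
have := ab; rewrite xpair_eqE; move/eqP: f1; move/eqP: f2; rewrite !mulf_eq0 !subr_eq0.
by move=> /orP[/eqP ->|/eqP ->]; rewrite ?subrr // => /orP[/eqP ->|/eqP ->];
  rewrite ?subrr ?eqxx.
Qed.

Lemma seg_l a b : seg a b a.
Proof. by exists 0; rewrite ?pt_on0 //= in_itv /= lexx ler01. Qed.

Lemma seg_r a b : seg a b b.
Proof. by exists 1; rewrite ?pt_on1 //= in_itv /= lexx ler01. Qed.

Lemma seg_compact a b : compact (seg a b).
Proof.
apply: continuous_compact; last exact: segment_compact.
exact: continuous_subspaceT (@pt_on_continuous a b).
Qed.

Lemma seg_closed a b : closed (seg a b).
Proof. by apply: compact_closed (@seg_compact a b); exact: norm_hausdorff. Qed.

Lemma seg_connected a b : connected (seg a b).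
Proof.
apply: connected_continuous_connected; first exact: segment_connected.
exact: continuous_subspaceT (@pt_on_continuous a b).
Qed.

Lemma star_connected S x : S x -> (forall y, S y -> seg x y `<=` S) -> connected S.
Proof.
move=> Sx star; have -> : S = \bigcup_(y in S) seg x y.
  apply/seteqP; split => [y Sy|y [z Sz /(star z Sz)//]].
  by exists y => //; exact: seg_r.
apply: bigcup_connected => [|y _]; last exact: seg_connected.
by exists x => y _; exact: seg_l.
Qed.

Lemma ball_connected x e : connected (ball x e).
Proof.
have [e0|e0] := ltP 0 e; last first.
  rewrite (_ : ball x e = set0); first exact: connected0.
  apply/seteqP; split => // y [+ _]; rewrite /ball /= => h.
  by have := le_lt_trans (normr_ge0 _) h; rewrite ltNge e0.
apply: (@star_connected _ x); first exact: ballxx.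
move=> y [y1 y2] _ [t + <-]; rewrite /= in_itv /= => /andP[t0 t1].
have H (u v : R) : `|u - v| < e -> `|u - ((1 - t) * u + t * v)| < e.
  move=> uv; have -> : u - ((1 - t) * u + t * v) = t * (u - v) by ring.
  rewrite normrM ger0_norm //; apply: le_lt_trans uv.
  by rewrite -[leRHS]mul1r ler_wpM2r.
by split; apply: H.
Qed.

(** A ball that misses [B] lies in one component of the complement. A polygon is thus both open and
    closed relative to that complement. *)
Lemma polygon_locally_constant B x : closed B -> ~ B x ->
  \forall y \near x, polygon B y <-> polygon B x.
Proof.
move=> Bc Bx; have : nbhs x (~` B) by apply: open_nbhs_nbhs; split => //; exact: closed_openC.
move=> /nbhs_ballP[e /= e0 eB]; apply/nbhs_ballP; exists e => // y xy.
have ccxy : connected_component (~` B) x y.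
  by exists (ball x e) => //; split; [exact: ballxx|exact: eB|exact: ball_connected].
rewrite /polygon /= -(same_connected_component ccxy).
by split=> -[_ h]; split => //; exact: eB.
Qed.

Lemma polygon_open B : closed B -> open (polygon B).
Proof.
move=> Bc; rewrite openE => x [Bx bx]; rewrite /interior.
apply: filterS (polygon_locally_constant Bc Bx) => y h; exact/h.
Qed.

Lemma closure_polygon B x : closed B -> closure (polygon B) x -> B x \/ polygon B x.
Proof.
move=> Bc cx; have [Bx|Bx] := pselect (B x); [by left|right].
have [y [Py +]] := cx _ (polygon_locally_constant Bc Bx).
by move=> h; exact/h.
Qed.

Lemma convex_connected S x : S x ->
  (forall y z t, S y -> S z -> 0 <= t <= 1 -> S (pt_on y z t)) -> connected S.
Proof.
move=> Sx cv; apply: (@star_connected _ x) => // y Sy _ [t + <-].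
by rewrite /= in_itv /=; exact: cv.
Qed.

Lemma punctured_ball_connected x e : 0 < e -> connected (ball x e `\ x).
Proof.
(* The punctured ball is the union of the four open half balls cut out by the coordinate lines
   through [x]. Each is convex, and they are glued one after the other at common points. *)
move=> e0; pose H (c : R * R) := [set y | ball x e y /\ 0 < c.1 * (y.1 - x.1) + c.2 * (y.2 - x.2)].
have cv c y z t : H c y -> H c z -> 0 <= t <= 1 -> H c (pt_on y z t).
  move=> [[y1 y2] yc] [[z1 z2] zc] /andP[t0 t1].
  have K (u v w : R) : `|u - v| < e -> `|u - w| < e -> `|u - ((1 - t) * v + t * w)| < e.
    rewrite !ltr_norml => /andP[? ?] /andP[? ?].
    have [t00|tn] := eqVneq t 0; first by rewrite t00; apply/andP; split; nra.
    have tp : 0 < t by rewrite lt_neqAle eq_sym tn.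
    by apply/andP; split; nra.
  split; first by split; apply: K.
  rewrite /=; have -> : c.1 * ((1 - t) * y.1 + t * z.1 - x.1) + c.2 * ((1 - t) * y.2 + t * z.2 - x.2)
    = (1 - t) * (c.1 * (y.1 - x.1) + c.2 * (y.2 - x.2)) + t * (c.1 * (z.1 - x.1) + c.2 * (z.2 - x.2))
    by ring.
  have [->|tn] := eqVneq t 0; first by rewrite subr0 mul1r mul0r addr0.
  have tp : 0 < t by rewrite lt_neqAle eq_sym tn.
  by rewrite ltr_wpDl ?mulr_gt0 // mulr_ge0 ?subr_ge0 // ltW.
have inb s1 s2 : -1 <= s1 <= 1 -> -1 <= s2 <= 1 -> ball x e (x.1 + s1 * (e / 2), x.2 + s2 * (e / 2)).
  have K (u s : R) : -1 <= s <= 1 -> `|u - (u + s * (e / 2))| < e.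
    by move=> /andP[? ?]; rewrite ltr_norml; apply/andP; split; nra.
  by split; apply: K.
have H1 s1 s2 c : -1 <= s1 <= 1 -> -1 <= s2 <= 1 -> 0 < c.1 * s1 + c.2 * s2 ->
    H c (x.1 + s1 * (e / 2), x.2 + s2 * (e / 2)).
  move=> h1 h2 h; split; first exact: inb.
  by rewrite /= ![x.1 + _]addrC ![x.2 + _]addrC !addrK; nra.
have -> : ball x e `\ x = ((H (1, 0) `|` H (0, 1)) `|` H (-1, 0)) `|` H (0, -1).
  apply/seteqP; split => [y [xy yx]|y].
    have [d1|d1|d1] := ltgtP y.1 x.1.
    - by left; right; split => //=; lra.
    - by left; left; left; split => //=; lra.
    - have [d2|d2|d2] := ltgtP y.2 x.2.
      + by right; split => //=; lra.
      + by left; left; right; split => //=; lra.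
      + by exfalso; apply: yx; rewrite [y]surjective_pairing [x]surjective_pairing d1 d2.
  by move=> [[[|]|]|] [xy h]; split => // yx; move: h; rewrite yx !subrr !mulr0 addr0 ltxx.
have cH c s1 s2 : -1 <= s1 <= 1 -> -1 <= s2 <= 1 -> 0 < c.1 * s1 + c.2 * s2 -> connected (H c).
  by move=> h1 h2 h; apply: (convex_connected (H1 _ _ _ h1 h2 h)); exact: cv.
have i1 : -1 <= (1 : R) <= 1 by lra. have i0 : -1 <= (0 : R) <= 1 by lra.
have im : -1 <= (-1 : R) <= 1 by lra.
apply: connectedU.
- exists (x.1 + 1 * (e / 2), x.2 + -1 * (e / 2)); split; [left; left|]; last by apply: H1 => //=; lra.
  by apply: H1 => //=; lra.
- apply: connectedU.
  + exists (x.1 + -1 * (e / 2), x.2 + 1 * (e / 2)); split; last by apply: H1 => //=; lra.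
    by right; apply: H1 => //=; lra.
  + apply: connectedU.
    * exists (x.1 + 1 * (e / 2), x.2 + 1 * (e / 2)); by split; apply: H1 => //=; lra.
    * by apply: (cH _ 1 0) => //=; lra.
    * by apply: (cH _ 0 1) => //=; lra.
  + by apply: (cH _ (-1) 0) => //=; lra.
- by apply: (cH _ 0 (-1)) => //=; lra.
Qed.

End PlaneTopology.

(** * Connectedness of the mesh *)

Section MeshGeometry.
Variables (R : realType) (m : mesh R).
Hypothesis hm : is_mesh m.

Local Notation xvertex := (@xvertex R m).
Local Notation cell_set := (@cell_set R m).
Local Notation vertices_of := (@vertices_of R m).

Definition cell_boundary (K : cell m) : set (R * R) :=
  [set x | exists (e : edge m) (o : bool), side e o = inl K /\ edge_seg e x].

Lemma closed_andP (T : topologicalType) (P : Prop) (F : set T) :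
  closed F -> closed [set x | P /\ F x].
Proof.
move=> cF; have [p|np] := pselect P.
  have E : [set x | P /\ F x] = F by apply/seteqP; split => x //= [].
  by rewrite E.
have E : [set x | P /\ F x] = set0 by apply/seteqP; split => x //= [].
by rewrite E; exact: closed0.
Qed.

Lemma cell_boundary_closed K : closed (cell_boundary K).
Proof.
apply: closed_finite_exists => e; apply: closed_finite_exists => o.
apply: closed_andP; exact: seg_closed.
Qed.

Lemma cell_open K : open (cell_set K).
Proof. exact: polygon_open (@cell_boundary_closed K). Qed.

Lemma dual_open v : open (@dual_set R m v).
Proof.
apply: polygon_open; apply: closed_finite_exists => e; apply: closed_finite_exists => o.
apply: closed_andP; apply: (@closedU _ (dual_edge_seg e)); first exact: seg_closed.
have E : [set x | exists2 b : bedge m, e = inr b & seg (pcenter (inr b : pnode m)) (xvertex v) x] =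
  [set x | exists b : bedge m, e = inr b /\ seg (pcenter (inr b : pnode m)) (xvertex v) x].
  by apply/seteqP; split => x [b]; [exists b|move=> []; exists b].
rewrite [X in closed X]E.
apply: closed_finite_exists => b; apply: closed_andP; exact: seg_closed.
Qed.

Lemma diamond_open e : open (@diamond R m e).
Proof.
apply: polygon_open; apply: closed_finite_exists => o; apply: closed_finite_exists => j.
exact: seg_closed.
Qed.

Lemma fconnect_vertices K v w : v \in vertices_of K -> w \in vertices_of K ->
  exists k, iter k (next (vertices_of K)) v = w.
Proof.
move=> vK wK; have c := cycle_next (vertices_of_uniq hm K).
have := fconnect_cycle c vK w; rewrite wK => /iter_findex; by exists (findex (next (vertices_of K)) v w).
Qed.

Lemma next_neq K v : v \in vertices_of K -> next (vertices_of K) v != v.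
Proof.
move=> vK; apply/eqP => nv; have all_v w : w \in vertices_of K -> w = v.
  by move=> /(fconnect_vertices vK)[k <-]; elim: k => //= k ->.
have := vertices_of_size hm K; rewrite -(card_uniqP (vertices_of_uniq hm K)).
rewrite ltnNge (leq_trans _ (leqnSn 1)) // -(card1 v) subset_leq_card //.
by apply/fintype.subsetP => w /all_v ->; rewrite inE.
Qed.

Lemma ends_neq (e : edge m) : ends e false != ends e true.
Proof.
have [j [vK nK]] := cell_of_edge hm (e := e) (o := false) (K := left_cell e) erefl.
have : ends e (~~ j) != ends e j by rewrite nK next_neq.
by case: j {vK nK} => //=; rewrite eq_sym.
Qed.

Lemma xend_neq (e : edge m) : xend e false != xend e true.
Proof. by apply: contra_neq (ends_neq e) => /(xvertex_inj hm). Qed.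

Lemma edge_seg_end (e : edge m) o : edge_seg e (xend e o).
Proof. by case: o; [exact: seg_r|exact: seg_l]. Qed.

Lemma vertex_on_edge (e : edge m) v : edge_seg e (xvertex v) -> exists o, xvertex v = xend e o.
Proof.
move=> ev; have [K vK] := vertex_covered hm v.
have [e' [q [j [_ e'v _]]]] := edge_of_cell hm vK.
have e'x : edge_seg e' (xvertex v) by rewrite -e'v; exact: edge_seg_end.
have [->|ee'] := eqVneq e e'; first by exists j; rewrite /xend e'v.
by have [q1 [_ [_ ->]]] := conforming hm ee' ev e'x; exists q1.
Qed.

Section CellConnectivity.
Variable Q : cell m -> Prop.
Hypothesis QI : forall i : iedge m, Q (@left_cell R m (inl i)) <-> Q (right_cell i).

(** A point in the closures of two distinct cells is on an edge of each. Off the vertices,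
    conformity makes the two edges equal, and an edge with two different cells is an interior
    edge. *)
Lemma cell_step K L x : domain m x -> (forall v : vertex m, x <> xvertex v) ->
  closure (cell_set K) x -> closure (cell_set L) x -> Q K -> Q L.
Proof.
move=> Ox nv Kx Lx QK; have [<-//|KL] := eqVneq K L.
have bnd (K' L' : cell m) : K' != L' -> closure (cell_set K') x -> closure (cell_set L') x ->
    cell_boundary K' x.
  move=> KL' /(closure_polygon (@cell_boundary_closed K'))[//|K'x] L'x.
  have [y [yL yK]] := L'x _ (open_nbhs_nbhs (conj (@cell_open K') K'x)).
  by have /seteqP[/(_ y)] := cell_disjoint hm KL'; case.
have [e [q [eK ex]]] := bnd K L KL Kx Lx.
have [|e' [j [e'L e'x]]] := bnd L K _ Lx Kx; first by rewrite eq_sym.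
have [ee'|ee'] := eqVneq e e'; last first.
  by have [q1 [_ [_ /nv]]] := conforming hm ee' ex e'x.
subst e'; case: e eK e'L {ex e'x} => [i|b].
  by have := QI i; case: q; case: j => /= h [h1] [h2]; move: KL QK; rewrite -h1 -h2 ?eqxx // => _ /h.
by case: q; case: j => //= -[h1] [h2]; move: KL; rewrite -h1 -h2 eqxx.
Qed.

(** The closures of the cells in [Q] and of those outside [Q] are two closed sets that cover [C]; by
    [cell_step] they do not meet on [C]. *)
Lemma cells_connected_through (C : set (R * R)) K L : connected C -> C `<=` domain m ->
  (forall v x, C x -> x <> xvertex v) -> C `&` cell_set K !=set0 -> C `&` cell_set L !=set0 ->
  Q K -> Q L.
Proof.
move=> Cc Cm nv [y [Cy yK]] [z [Cz zL]] QK.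
pose U (P : cell m -> Prop) := [set x | exists M : cell m, P M /\ closure (cell_set M) x].
have Uc P : closed (U P).
  by apply: closed_finite_exists => M; apply: closed_andP; exact: closed_closure.
have : C `&` U Q = C.
  apply: Cc.
  - by exists y; split => //; exists K; split => //; exact: subset_closure.
  - exists (~` U (fun M => ~ Q M)); first exact: closed_openC.
    apply/seteqP; split => x [Cx].
      move=> [M [QM Mx]]; split => // -[M' [nQ M'x]]; apply: nQ.
      by apply: (cell_step (Cm _ Cx) _ Mx M'x QM) => v; exact: nv.
    move=> nU; split => //; have [M Mx] := cell_cover hm (Cm _ Cx).
    have [QM|nQ] := pselect (Q M); first by exists M.
    by exfalso; apply: nU; exists M.
  - by exists (U Q).
move/seteqP => [_ /(_ z Cz) [_ [M [QM Mz]]]].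
apply: (cell_step (Cm _ Cz) _ Mz _ QM) => [v|]; first exact: nv.
exact: subset_closure.
Qed.

Lemma cells_locally_connected x : domain m x ->
  exists2 e : R, 0 < e & forall K L, ball x e `&` cell_set K !=set0 ->
    ball x e `&` cell_set L !=set0 -> Q K -> Q L.
Proof.
move=> Ox.
have N1 : nbhs x (domain m) by apply: open_nbhs_nbhs; split => //; exact: domain_open.
have N2 : nbhs x [set y | forall v, xvertex v <> x -> y <> xvertex v].
  refine (@filter_forall _ (vertex m) (fun v => [set y | xvertex v <> x -> y <> xvertex v]) (nbhs x) _ _) => v.
  have [->|vx] := pselect (xvertex v = x).
    by apply: filterS filterT => y _ [].
  have : nbhs x (~` [set xvertex v]).
    apply: open_nbhs_nbhs; split; last by move=> /esym.
    apply: closed_openC; apply: accessible_closed_set1; apply: hausdorff_accessible.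
    exact: norm_hausdorff.
  by apply: filterS => y yv _.
have [e /= e0 eB] := (nbhs_ballP _ _).1 (filterI N1 N2).
exists e => // K L xK xL.
have punct M : ball x e `&` cell_set M !=set0 -> (ball x e `\ x) `&` cell_set M !=set0.
  move=> [y [xy yM]]; have [yx|yx] := pselect (y = x); last by exists y.
  have [d /= d0 dB] := (nbhs_ballP _ _).1 (open_nbhs_nbhs (conj (@cell_open M) yM)).
  pose z : R * R := (x.1 + Num.min e d / 2, x.2).
  have k0 : 0 < Num.min e d by rewrite lt_min e0.
  have z1 r : Num.min e d <= r -> ball x r z.
    move=> kr; have r0 := lt_le_trans k0 kr; split; last exact: ballxx.
    rewrite /z /ball /= opprD addrA subrr sub0r normrN gtr0_norm ?divr_gt0 //; lra.
  exists z; have zd : ball y d z by rewrite yx; apply: z1; rewrite ge_min lexx orbT.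
  have zM := dB z zd; split => //; split; first by apply: z1; rewrite ge_min lexx.
  move=> zx; have : z.1 = x.1 by rewrite zx.
  by rewrite /z /=; lra.
have pc := @punctured_ball_connected R x e e0.
apply: (@cells_connected_through _ K L pc).
- by move=> y [/eB[]].
- by move=> v y [/eB[_ /(_ v) h] yx] yv; apply: h => // vx; apply: yx; rewrite yv vx.
- exact: punct.
- exact: punct.
Qed.

Theorem cells_connected K L : Q K -> Q L.
Proof.
move=> QK; pose U := [set x | exists M : cell m, Q M /\ closure (cell_set M) x].
have Uc : closed U.
  by apply: closed_finite_exists => M; apply: closed_andP; exact: closed_closure.
have loc x : domain m x -> U x -> exists2 e : R, 0 < e & forall y, ball x e y ->
    forall M, closure (cell_set M) y -> Q M.
  move=> Ox [M [QM Mx]]; have [e e0 he] := cells_locally_connected Ox.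
  exists e => // y xy M' My; apply: (he M M') => //.
    by rewrite setIC; exact: Mx (nbhsx_ballx x e e0).
  by rewrite setIC; apply: My; apply: open_nbhs_nbhs; split => //; exact: ball_open.
have : domain m `&` U = domain m.
  apply: (domain_connected hm).
  - exists (xcell K); have Kx := xcell_in hm K.
    by split; [exact: cell_sub Kx|exists K; split => //; exact: subset_closure].
  - exists (domain m `&` U); last by rewrite setIA setIid.
    rewrite openE => x [Ox Ux]; have [e e0 he] := loc x Ox Ux.
    apply: filterS (filterI (open_nbhs_nbhs (conj (domain_open hm) Ox)) (nbhsx_ballx x e e0)).
    move=> y [Oy xy]; split => //; have [M My] := cell_cover hm Oy.
    by exists M; split => //; exact: he My.
  - by exists U.
move/seteqP => [_ /(_ (xcell L))]; have Lx := xcell_in hm L; have OL := cell_sub hm Lx.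
move=> /(_ OL)[_ UL]; have [e e0 he] := loc _ OL UL.
by apply: (he (xcell L)); [exact: ballxx|exact: subset_closure].
Qed.

End CellConnectivity.

Lemma pt_on_interior_neq (e : edge m) (t : R) v :
  0 < t < 1 -> pt_on (xend e false) (xend e true) t <> xvertex v.
Proof.
move=> /andP[t0 t1] tv.
have [|q vq] := @vertex_on_edge e v.
  by exists t; rewrite //= in_itv /= !ltW.
have tq : t = if q then 1 else 0.
  by apply: (pt_on_fst _ (xend_neq e)); rewrite tv vq; case: (q); rewrite ?pt_on1 ?pt_on0.
by move: t0 t1; rewrite tq; case: (q); rewrite ltxx.
Qed.

(** Positive measure puts a Dirichlet point inside some boundary edge. On the open edge, which has
    no vertex, the closed sets [GammaDir] and [GammaN] are disjoint and cover it, so by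
    connectedness all of it is Dirichlet, and closedness adds the endpoint. The midpoint anchors the
    primal graph and the endpoint anchors the dual one. *)
Lemma dirichlet_bedge : exists b : bedge m,
  dirichlet (inl (inr b) : node m) /\ dirichlet (inr (@ends R m (inr b) false) : node m).
Proof.
pose pt (b : bedge m) := pt_on (@xend R m (inr b) false) (@xend R m (inr b) true).
have [b [t t01 Gt]] : exists b, exists2 t, 0 < t < 1 & GammaDir m (pt b t).
  (* Otherwise [GammaDir] would meet each boundary edge at most at its two endpoints, a set of
     measure zero. *)
  apply: contrapT => nex; have := GammaDir_pos hm; rewrite /boundary_measure big1 ?ltxx // => b _.
  rewrite countable_lebesgue_measure0 ?mule0 //.
  apply: (@sub_countable _ _ _ [set 0; 1 : R]); last first.
    by apply: finite_set_countable; rewrite finite_setU; split; exact: finite_set1.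
  apply: subset_card_le => t /= [/andP[t0 t1] Gt]; apply: contrapT => t01; apply: nex.
  exists b, t => //; apply/andP; split; rewrite lt_neqAle ?t0 ?t1 andbT; apply/eqP => h; apply: t01.
    by left.
  by right.
have ptE s : 0 < s < 1 -> (closure (domain m) `\` domain m) (pt b s).
  move=> /andP[s0 s1]; rewrite (domain_boundary hm); exists b.
  by exists s; rewrite //= in_itv /= !ltW.
have cl (F : set (R * R)) : closed F -> closed (pt b @^-1` F).
  by apply: (continuous_closedP _).1; exact: pt_on_continuous.
have GN s : 0 < s < 1 -> GammaDir m (pt b s) -> ~ GammaN m (pt b s).
  move=> s01 Ds Ns; have [v _ vs] := GammaDirN_vertices hm (conj Ds Ns).
  by apply: (pt_on_interior_neq s01 (esym vs)).
have all_dir : `]0, 1[%classic `&` (pt b @^-1` GammaDir m) = `]0, 1[%classic.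
  have : connected (`]0, 1[%classic : set R) by apply/connected_intervalP; exact: interval_is_interval.
  apply.
  - by exists t; split => //; rewrite /= in_itv.
  - exists (~` (pt b @^-1` GammaN m)); first by apply: closed_openC; apply: cl; exact: GammaN_closed.
    apply/seteqP; split => s [s01]; have s01' : 0 < s < 1 by move: s01; rewrite /= in_itv.
      by move=> Ds; split => //; exact: GN.
    by move=> nN; split => //; have := ptE _ s01'; rewrite (boundary_split hm) => -[].
  - by exists (pt b @^-1` GammaDir m) => //; apply: cl; exact: GammaDir_closed.
have inD s : 0 < s < 1 -> GammaDir m (pt b s).
  move=> s01; suff [] : (`]0, 1[%classic `&` (pt b @^-1` GammaDir m)) s by [].
  by rewrite all_dir /= in_itv.
exists b; split; first by apply: inD; rewrite invr_gt0 ltr0n invf_lt1 // ltr1n.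
suff : GammaDir m (pt b 0) by rewrite /pt pt_on0.
apply: (cl _ (GammaDir_closed hm)) => B /nbhs_ballP[e /= e0 eB].
pose s := Num.min e 1 / 2; have k0 : 0 < Num.min e 1 by rewrite lt_min e0 ltr01.
have ke : Num.min e 1 <= e by rewrite ge_min lexx.
have k1 : Num.min e 1 <= 1 by rewrite ge_min lexx orbT.
exists s; split; first by apply: inD; rewrite /s; apply/andP; split; lra.
by apply: eB; rewrite /ball /= sub0r normrN gtr0_norm /s ?divr_gt0 //; lra.
Qed.

Theorem nodes_connected (P : node m -> Prop) : (forall A, dirichlet A -> P A) ->
  (forall e k, P (nd e k false) <-> P (nd e k true)) -> forall A, P A.
Proof.
move=> PD PE; have [b [Db Dv]] := dirichlet_bedge.
have Pcell K : P (inl (inl K)).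
  apply: (cells_connected (Q := fun K => P (inl (inl K))) _ (K := @left_cell R m (inr b))).
    by move=> i; exact: (PE (inl i) false).
  by apply/(PE (inr b) false); exact: PD.
have PEv (e : edge m) j : P (inr (ends e j)) -> P (inr (ends e (~~ j))).
  by have := PE e true; case: j => /= h /h.
(* The connectedness of the cells is reused for the vertices: one good vertex of a cell makes all of
   them good, going round the cell along its edges, and adjacent cells share the two ends of an
   edge. *)
pose Q K := forall v, v \in vertices_of K -> P (inr v).
have QP K v : v \in vertices_of K -> P (inr v) -> Q K.
  move=> vK Pv w wK; have [k <-] := fconnect_vertices vK wK.
  suff [] : P (inr (iter k (next (vertices_of K)) v)) /\
    iter k (next (vertices_of K)) v \in vertices_of K by [].
  elim: k => //= k []; set u := iter _ _ _ => Pu uK; split; last by rewrite mem_next.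
  have [e [q [j [_ eu <-]]]] := edge_of_cell hm uK.
  by apply: PEv; rewrite eu.
have QI i : Q (@left_cell R m (inl i)) <-> Q (right_cell i).
  have [j [vl nl]] := @cell_of_edge R m hm (inl i) false _ erefl.
  have [j' [vr nr]] := @cell_of_edge R m hm (inl i) true _ erefl.
  have el q : @ends R m (inl i) q \in vertices_of (@left_cell R m (inl i)).
    by have [->//|qj] := eqVneq q j; rewrite (_ : q = ~~ j) ?nl ?mem_next //; case: (q) (j) qj => -[].
  have er q : @ends R m (inl i) q \in vertices_of (right_cell i).
    by have [->//|qj] := eqVneq q j'; rewrite (_ : q = ~~ j') ?nr ?mem_next //; case: (q) (j') qj => -[].
  by split=> h; [apply: QP (er true) (h _ (el true))|apply: QP (el true) (h _ (er true))].
have Qall K : Q K.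
  have [K0 vK0] := vertex_covered hm (@ends R m (inr b) false).
  by apply: (cells_connected QI (K := K0)); apply: QP vK0 _; exact: PD.
case=> [[K|b']|v] //.
  by apply/(PE (inr b') false); exact: Pcell.
by have [K vK] := vertex_covered hm v; exact: Qall vK.
Qed.

End MeshGeometry.

(** * Coefficients *)

Section AeMeans.
Context d (T : measurableType d) (R : realType) (mu : {measure set T -> \bar R}).
Lemma ae_imply (P Q : T -> Prop) : (forall x, P x -> Q x) ->
  {ae mu, forall x, P x} -> {ae mu, forall x, Q x}.
Proof. by move=> PQ; apply: filterS. Qed.

Variables (D : set T).
Hypothesis mD : measurable D.

Lemma Rintegral_ae_ge0 (g : T -> R) : measurable_fun D g ->
  {ae mu, forall x, D x -> 0 <= g x} -> 0 <= \int[mu]_(x in D) g x.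
Proof.
move=> mg g0; have mg' : measurable_fun D (EFin \o g) by apply/measurable_EFinP.
have mg2 : measurable_fun D (EFin \o (fun x => Num.max (g x) 0)).
  by apply/measurable_EFinP; apply: measurable_maxr => //; exact: measurable_cst.
rewrite /Rintegral (ae_eq_integral (EFin \o (fun x => Num.max (g x) 0))) //.
  by apply: fine_ge0; apply: integral_ge0 => x _; rewrite lee_fin le_max lexx orbT.
by apply: filterS g0 => x h Dx /=; rewrite max_l // h.
Qed.

Lemma ae_bounded_integrable (g : T -> R) (C : R) : (mu D < +oo)%E -> measurable_fun D g ->
  {ae mu, forall x, D x -> `|g x| <= C} -> mu.-integrable D (EFin \o g).
Proof.
move=> Dfin mg gC; apply/integrableP; split; first exact/measurable_EFinP.
apply: (@le_lt_trans _ _ (\int[mu]_(x in D) `|C|%:E)%E); last first.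
  rewrite integral_cst //; have := Dfin; rewrite -ge0_fin_numE // => h.
  by rewrite -(fineK h) -EFinM ltry.
apply: ae_ge0_le_integral => //.
- by apply: measurableT_comp => //; exact/measurable_EFinP.
- by apply: filterS gC => x h Dx; rewrite lee_fin (le_trans (h Dx)) // ler_norm.
Qed.

Lemma mxdotE (A : 'M[R]_2) (u v : R * R) : mxdot A u v =
  A 0 0 * (u.1 * v.1) + A 0 1 * (u.2 * v.1) + A 1 0 * (u.1 * v.2) + A 1 1 * (u.2 * v.2).
Proof.
rewrite /mxdot !mxE !big_ord_recl !big_ord0 !mxE !big_ord_recl !big_ord0 !mxE /=.
rewrite (_ : lift ord0 ord0 = 1); last exact: val_inj.
by rewrite (_ : 0 = ord0) //; ring.
Qed.

Lemma mxdotC (A : 'M[R]_2) (u v : R * R) : A^T = A -> mxdot A u v = mxdot A v u.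
Proof.
by move=> /matrixP/(_ 0 1); rewrite mxE !mxdotE => ->; ring.
Qed.

Lemma enorm_sqr (v : R * R) : enorm v ^+ 2 = v.1 ^+ 2 + v.2 ^+ 2.
Proof. by rewrite /enorm sqr_sqrtr /dot -!expr2 // addr_ge0 ?sqr_ge0. Qed.

Variables (Lambda : T -> 'M[R]_2) (lo hi : R).
Hypotheses (Dfin : (mu D < +oo)%E) (D0 : 0 < fine (mu D))
  (mL : forall i j, measurable_fun D (fun x => Lambda x i j))
  (hL : {ae mu, forall x, D x -> (Lambda x)^T = Lambda x /\ forall v : R * R,
          lo * enorm v ^+ 2 <= mxdot (Lambda x) v v <= hi * enorm v ^+ 2}).

Let A : 'M[R]_2 := \matrix_(i, j) ((fine (mu D))^-1 * \int[mu]_(x in D) Lambda x i j).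

Lemma mean_sym : A^T = A.
Proof.
apply/matrixP => i j; rewrite !mxE; congr (_ * fine _).
apply: ae_eq_integral => //; try exact/measurable_EFinP.
apply: filterS hL => x h Dx; have [/matrixP/(_ i j)] := h Dx.
by rewrite mxE /= => ->.
Qed.

Let Lambda_integrable i j : mu.-integrable D (EFin \o (fun x => Lambda x i j)).
Proof.
apply: (@ae_bounded_integrable _ (`|lo| + `|hi|)) => //.
apply: filterS hL => x h Dx; have [/matrixP s b] := h Dx.
have s01 : Lambda x 1 0 = Lambda x 0 1 by rewrite -[LHS](s 1 0) mxE.
(* Polarization: these four values of the quadratic form bound every entry of the symmetric
   matrix. *)
have := b (1, 0); have := b (0, 1); have := b (1, 1); have := b (1, -1).
rewrite !mxdotE !enorm_sqr /= s01.
move=> /andP[b1 b2] /andP[b3 b4] /andP[b5 b6] /andP[b7 b8].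
have N (c : R) : - `|c| <= c <= `|c| by rewrite lerNl -{1}normrN !ler_norm.
have /andP[l1 l2] := N lo; have /andP[h1 h2] := N hi.
have I2 (k : 'I_2) : k = 0 \/ k = 1 by case: k => [[|[]//] ?]; [left|right]; exact: val_inj.
rewrite ler_norml; case: (I2 i) => ->; case: (I2 j) => ->; rewrite ?s01;
  by apply/andP; split; lra.
Qed.

Lemma mean_coercive (v : R * R) : lo * enorm v ^+ 2 <= mxdot A v v.
Proof.
pose g x := Lambda x 0 0 * (v.1 * v.1) + Lambda x 0 1 * (v.2 * v.1) +
  Lambda x 1 0 * (v.1 * v.2) + Lambda x 1 1 * (v.2 * v.2) - lo * enorm v ^+ 2.
have Li i j (c : R) : mu.-integrable D (EFin \o (fun x => Lambda x i j * c)).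
  exact: (integrableZr mD c (Lambda_integrable i j)).
have LD (g1 g2 : T -> R) : mu.-integrable D (EFin \o g1) -> mu.-integrable D (EFin \o g2) ->
    mu.-integrable D (EFin \o (fun x => g1 x + g2 x)).
  by move=> i1 i2; exact: (integrableD mD i1 i2).
have cst_int : mu.-integrable D (EFin \o cst (lo * enorm v ^+ 2)).
  apply: (@ae_bounded_integrable _ `|lo * enorm v ^+ 2|) => //.
  by apply: nearW => x _ /=.
have i12 := LD _ _ (Li 0 0 (v.1 * v.1)) (Li 0 1 (v.2 * v.1)).
have i123 := LD _ _ i12 (Li 1 0 (v.1 * v.2)).
have i1234 := LD _ _ i123 (Li 1 1 (v.2 * v.2)).
have : 0 <= \int[mu]_(x in D) g x.
  apply: Rintegral_ae_ge0.
    apply/measurable_EFinP.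
    have := measurable_int mu (integrableB mD i1234 cst_int).
    by apply: eq_measurable_fun => x _.
  apply: filterS hL => x h Dx; have [_ /(_ v)/andP[+ _]] := h Dx.
  by rewrite mxdotE /g subr_ge0.
rewrite /g RintegralB // Rintegral_cst // !RintegralD // !RintegralZr //.
rewrite mxdotE !mxE => h.
rewrite -subr_ge0 -(pmulr_rge0 _ D0); apply: le_trans h _.
have Dn := lt0r_neq0 D0; rewrite le_eqVlt; apply/orP; left; apply/eqP.
by field.
Qed.

End AeMeans.

(** * Measurability of plane open sets *)

Section PlaneMeasure.
Variable R : realType.
Local Notation plane := (measurableTypeR R * measurableTypeR R)%type.

(** Balls of the sup norm are products of intervals, and an open set is the union of the countably
    many rational ones that it contains. *)
Lemma plane_open_measurable (U : set (R * R)) : open U -> measurable (U : set plane).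
Proof.
move=> oU.
pose B (q : rat * rat * rat) : set (R * R) :=
  ball ((ratr q.1.1, ratr q.1.2) : R * R) (ratr q.2).
have -> : U = \bigcup_q (if `[< B q `<=` U >] then B q else set0).
  apply/seteqP; split => [x Ux|x [q _]]; last by case: asboolP => // h /h.
  have [e /= e0 eU] := (nbhs_ballP _ _).1 (open_nbhs_nbhs (conj oU Ux)).
  have [r] := rat_in_itvoo (divr_gt0 e0 (ltr0n R 2)).
  rewrite in_itv /= => /andP[r0 re].
  have near (u : R) : exists q : rat, `|ratr q - u| < ratr r.
    have ur : u < u + ratr r by rewrite ltrDl.
    have [q] := rat_in_itvoo ur; rewrite in_itv /= => /andP[? ?]; exists q.
    by rewrite ltr_norml; apply/andP; split; lra.
  have [q1 h1] := near x.1; have [q2 h2] := near x.2.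
  exists (q1, q2, r) => //; case: asboolP => [_|[]]; first by split; rewrite /ball /=.
  move=> y [/= y1 y2]; apply: eU; split; rewrite /ball /=.
    have -> : x.1 - y.1 = (ratr q1 - y.1) - (ratr q1 - x.1) by ring.
    by apply: le_lt_trans (ler_normB _ _) _; move: y1 h1; rewrite /ball /=; lra.
  have -> : x.2 - y.2 = (ratr q2 - y.2) - (ratr q2 - x.2) by ring.
  by apply: le_lt_trans (ler_normB _ _) _; move: y2 h2; rewrite /ball /=; lra.
apply: countable_bigcupT_measurable => [|q]; first exact: countableP.
case: asboolP => _; last exact: measurable0.
rewrite (_ : B q = ball (ratr q.1.1 : R) (ratr q.2) `*` ball (ratr q.1.2 : R) (ratr q.2)).
  by apply: measurableX; exact: measurable_ball.
by apply/seteqP; split.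
Qed.

End PlaneMeasure.

(** * Pore volumes, lengths and mean permeabilities *)

Section MeshCoefficients.
Variables (R : realType) (m : mesh R) (hm : is_mesh m).

Lemma porosity_ge0 (phi : R * R -> R) (A : set (R * R)) :
  is_porosity (domain m) phi -> open A -> A `<=` domain m -> 0 <= area A * mean A phi.
Proof.
move=> [mphi [phi0 [phi1 [p0 hphi]]]] oA AO.
rewrite /mean; have a0 : 0 <= area A by exact: fine_ge0.
rewrite mulrA mulr_ge0 //; first by rewrite mulr_ge0 // invr_ge0.
apply: Rintegral_ae_ge0.
- exact: plane_open_measurable.
- apply: measurable_funS mphi => //; exact: plane_open_measurable (domain_open hm).
- by apply: ae_imply hphi => x h /AO/h /andP[+ _]; apply: le_trans; exact: ltW.
Qed.

Lemma xside_neq (e : edge m) : xside e false != xside e true.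
Proof.
rewrite /xside; case: e => [i|b] /=.
  apply/eqP => E; have := cell_disjoint hm (left_right hm i) => /seteqP[/(_ (xcell (right_cell i)))+ _].
  by apply; split; [rewrite -E|]; exact: xcell_in.
apply/eqP => E; have : (closure (domain m) `\` domain m) (xcell (@left_cell R m (inr b))).
  rewrite E (domain_boundary hm); exists b; exists 2^-1 => //.
  by rewrite /= in_itv /= invr_ge0 ler0n invf_le1 // ler1n.
move=> [_]; apply; exact: cell_sub (xcell_in hm _).
Qed.

Lemma enorm_gt0 (u : R * R) : u != 0 -> 0 < enorm u.
Proof.
rewrite /enorm sqrtr_gt0 /dot -!expr2 => u0.
rewrite lt_neqAle addr_ge0 ?sqr_ge0 // andbT eq_sym paddr_eq0 ?sqr_ge0 // !sqrf_eq0.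
by apply: contraNN u0 => /andP[/eqP u1 /eqP u2]; rewrite [u]surjective_pairing u1 u2.
Qed.

Lemma edge_length_gt0 (e : edge m) : 0 < edge_length e.
Proof. by apply: enorm_gt0; rewrite subr_eq0 eq_sym xend_neq. Qed.

Lemma dual_length_gt0 (e : edge m) : 0 < dual_length e.
Proof. by apply: enorm_gt0; rewrite subr_eq0 eq_sym xside_neq. Qed.

(** If the cross product vanished, Lagrange's identity would make the cosine 1 or -1, and the sine
    of its [acos] would be 0. *)
Lemma sin_angle_gt0_indep (u v : R * R) : u != 0 -> v != 0 -> 0 < sin (angle u v) ->
  u.1 * v.2 - u.2 * v.1 != 0.
Proof.
move=> u0 v0; rewrite /angle; set q := _ / _ => sq; apply/eqP => uv.
have U := enorm_gt0 u0; have V := enorm_gt0 v0.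
have q2 : q ^+ 2 = 1.
  rewrite /q expr_div_n exprMn !enorm_sqr.
  have -> : dot u v ^+ 2 = (u.1 ^+ 2 + u.2 ^+ 2) * (v.1 ^+ 2 + v.2 ^+ 2) - (u.1 * v.2 - u.2 * v.1) ^+ 2.
    by rewrite /dot; ring.
  rewrite uv expr0n /= subr0 divff // -!enorm_sqr mulf_neq0 // sqrf_eq0 gt_eqF //.
have : -1 <= q <= 1 by rewrite -ler_norml -(@ler_pXn2r _ 2) ?nnegrE // real_normK ?num_real // q2 expr1n.
by move=> /sin_acos E; move: sq; rewrite E q2 subrr sqrtr0 ltxx.
Qed.

Variables (Lambda : R * R -> 'M[R]_2) (hL : is_permeability (domain m) Lambda).

Lemma Lambda_mean_spd (e : edge m) : (Lambda_mean Lambda e)^T = Lambda_mean Lambda e /\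
  forall v : R * R, v != 0 -> 0 < mxdot (Lambda_mean Lambda e) v v.
Proof.
have [mL [lo [hi [/andP[lo0 _] aeL]]]] := hL.
have oD := @diamond_open R m e; have sD := diamond_sub hm (e := e).
have mD := plane_open_measurable oD.
have a0 := diamond_area hm e; rewrite /area in a0.
have fD : ((leb2 R) (diamond e) < +oo)%E by rewrite ltey; apply/eqP => E; move: a0; rewrite E /= ltxx.
have mL' i j : measurable_fun (diamond e) (fun x => Lambda x i j).
  by apply: measurable_funS (mL i j) => //; exact: plane_open_measurable (domain_open hm).
have aeL' : {ae leb2 R, forall x, diamond e x -> (Lambda x)^T = Lambda x /\ forall v : R * R,
          lo * enorm v ^+ 2 <= mxdot (Lambda x) v v <= hi * enorm v ^+ 2}.
  by apply: ae_imply aeL => x h /sD /h.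
split; first exact: (mean_sym mD mL' aeL').
move=> v v0; have := mean_coercive mD fD a0 mL' aeL' v; apply: lt_le_trans.
by rewrite mulr_gt0 // exprn_gt0 // enorm_gt0.
Qed.

End MeshCoefficients.

(** * Positivity and coupling of the transmissibilities *)

Section Transmissibilities.
Variables (R : realType) (m : mesh R) (hm : is_mesh m)
  (Lambda : R * R -> 'M[R]_2) (hL : is_permeability (domain m) Lambda).

Definition transmissibility (e : edge m) (k : bool) : R :=
  if k then dual_tau Lambda e else tau Lambda e.

Lemma enorm1_neq0 (n : R * R) : enorm n = 1 -> n != 0.
Proof.
move=> n1; apply/eqP => n0; have := oner_neq0 R.
by rewrite -n1 n0 /enorm /dot /= mul0r addr0 sqrtr0 eqxx.
Qed.

(** If they were parallel, [n] would be orthogonal to both [u] and [v], which span the plane. *)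
Lemma normals_independent (u v n n' : R * R) : u.1 * v.2 - u.2 * v.1 != 0 ->
  n != 0 -> n' != 0 -> dot n v = 0 -> dot n' u = 0 -> n.1 * n'.2 - n.2 * n'.1 != 0.
Proof.
case: u v n n' => u1 u2 [v1 v2] [n1 n2] [k1 k2]; rewrite /dot /= => uv n0 k0 nv ku.
apply/eqP => nk.
have kk : k1 ^+ 2 + k2 ^+ 2 != 0.
  rewrite paddr_eq0 ?sqr_ge0 // !sqrf_eq0; apply: contraNN k0 => /andP[/eqP -> /eqP ->] //.
have nu : n1 * u1 + n2 * u2 = 0.
  have : (n1 * u1 + n2 * u2) * (k1 ^+ 2 + k2 ^+ 2) = 0.
    transitivity ((n1 * k1 + n2 * k2) * (k1 * u1 + k2 * u2) - (n1 * k2 - n2 * k1) * (k1 * u2 - k2 * u1)).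
      ring.
    by rewrite ku nk; ring.
  by move/eqP; rewrite mulf_eq0 (negPf kk) orbF => /eqP.
have z1 : n1 * (u1 * v2 - u2 * v1) = 0.
  transitivity ((n1 * u1 + n2 * u2) * v2 - (n1 * v1 + n2 * v2) * u2); first by ring.
  by rewrite nu nv; ring.
have z2 : n2 * (u1 * v2 - u2 * v1) = 0.
  transitivity ((n1 * v1 + n2 * v2) * u1 - (n1 * u1 + n2 * u2) * v1); first by ring.
  by rewrite nu nv; ring.
move/eqP: z1; move/eqP: z2; rewrite !mulf_eq0 (negPf uv) !orbF => /eqP n20 /eqP n10.
by move: n0; rewrite n10 n20 eqxx.
Qed.

Lemma strict_cauchy_schwarz (A : 'M[R]_2) (n n' : R * R) : A^T = A ->
  (forall v : R * R, v != 0 -> 0 < mxdot A v v) -> n' != 0 -> n.1 * n'.2 - n.2 * n'.1 != 0 ->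
  mxdot A n n' ^+ 2 < mxdot A n n * mxdot A n' n'.
Proof.
move=> As Ap n'0 nn'.
have c0 := Ap n' n'0; set c := mxdot A n' n' in c0 *; set b := mxdot A n n'.
(* Up to the factor c, the component of [n] that is A-orthogonal to [n']; independence makes it
   nonzero, whence the strict inequality. *)
pose w : R * R := (c * n.1 - b * n'.1, c * n.2 - b * n'.2).
have w0 : w != 0.
  apply/eqP => -[w1 w2]; move/eqP: nn'; apply.
  have : c * (n.1 * n'.2 - n.2 * n'.1) = 0.
    transitivity ((c * n.1 - b * n'.1) * n'.2 - (c * n.2 - b * n'.2) * n'.1); first by ring.
    by rewrite w1 w2; ring.
  by move/eqP; rewrite mulf_eq0 gt_eqF //= => /eqP.
have := Ap w w0.
have -> : mxdot A w w = c * (mxdot A n n * c - b ^+ 2).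
  transitivity (c ^+ 2 * mxdot A n n - c * b * mxdot A n n' - c * b * mxdot A n' n + b ^+ 2 * mxdot A n' n').
    by rewrite !mxdotE /w /=; ring.
  by rewrite (mxdotC n' n As) -/b -/c; ring.
by rewrite pmulr_rgt0 // subr_gt0.
Qed.

Lemma pnormal_unit (e : edge m) : enorm (pnormal e false) = 1 /\
  dot (pnormal e false) (xend e true - xend e false) = 0.
Proof. by have [] := @Defs.normalP R m hm e false _ erefl. Qed.

Lemma dnormal_unit (e : edge m) : enorm (dnormal e false) = 1 /\
  dot (dnormal e false) (xside e true - xside e false) = 0.
Proof. by have [] := @dual_normalP R m hm e false. Qed.

Lemma transmissibility_gt0 (e : edge m) k : 0 < transmissibility e k.
Proof.
have [As Ap] := Lambda_mean_spd hm hL e; have s0 := diamond_sin hm e.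
have l0 := edge_length_gt0 hm e; have d0 := dual_length_gt0 hm e.
rewrite /transmissibility; case: k; rewrite /tau /dual_tau mulr_gt0 ?divr_gt0 //; apply: Ap;
  apply: enorm1_neq0.
- by have [] := dnormal_unit e.
- by have [] := pnormal_unit e.
Qed.

(** The lengths cancel in the product of the two transmissibilities, which leaves the strict
    Cauchy-Schwarz inequality for the mean permeability and the two normals. *)
Lemma etaD_lt (e : edge m) : etaD Lambda e false false ^+ 2 < transmissibility e false * transmissibility e true.
Proof.
have [As Ap] := Lambda_mean_spd hm hL e; have s0 := diamond_sin hm e.
have l0 := edge_length_gt0 hm e; have d0 := dual_length_gt0 hm e.
have [n1 nv] := pnormal_unit e; have [n'1 n'u] := dnormal_unit e.
have u0 : xside e true - xside e false != 0 by rewrite subr_eq0 eq_sym xside_neq.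
have v0 : xend e true - xend e false != 0 by rewrite subr_eq0 eq_sym xend_neq.
have nn' := normals_independent (sin_angle_gt0_indep u0 v0 s0) (enorm1_neq0 n1) (enorm1_neq0 n'1) nv n'u.
have := strict_cauchy_schwarz As Ap (enorm1_neq0 n'1) nn'.
rewrite /etaD /transmissibility /tau /dual_tau.
set s := sin _; set l := edge_length e; set d := dual_length e.
set a := mxdot _ (pnormal e false) (pnormal e false).
set b := mxdot _ (pnormal e false) _; set c := mxdot _ _ _ => bac.
have -> : l / d * (a / s) * (d / l * (c / s)) = (a * c) / s ^+ 2.
  by field; rewrite !gt_eqF.
by rewrite expr_div_n ltr_pM2r // invr_gt0 exprn_gt0.
Qed.

Lemma etaD_orient (e : edge m) o o' : etaD Lambda e o o' = (-1) ^+ (o + o') * etaD Lambda e false false.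
Proof.
rewrite /etaD /pnormal /dnormal mulrA; congr (_ / _).
have S1 (a : R) (n : R * R) : (a *: n).1 = a * n.1 by [].
have S2 (a : R) (n : R * R) : (a *: n).2 = a * n.2 by [].
rewrite exprD !mxdotE !S1 !S2 !expr0 !mul1r.
set s := _ ^+ o; set t := _ ^+ o'; ring.
Qed.

End Transmissibilities.

(** * Reduction of the scheme to the network *)

Section SchemeNetwork.
Variables (R : realType) (m : mesh R) (phi : R * R -> R) (Lambda : R * R -> 'M[R]_2)
  (f : fluid R) (dt : R) (pn : phase -> node m -> R).

(** The component of a degenerate boundary cell is a single flux; a zero volume gives it the same
    form as the others. *)
Definition pore_volume (A : node m) : R :=
  if A is inl (inr _) then 0 else area (node_set A) * mean (node_set A) phi.

Lemma gflux_primal eps eta p a (e : edge m) o :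
  gflux f (transmissibility Lambda) (fun e => @etaD R m Lambda e false false) eps eta p a e false o =
  rho_mean f p a (inl (side e o)) (inl (side e (~~ o))) * V Lambda f eps p a e o +
  eta * (-1) ^+ deg a * (rho_mean f p a (inl (side e o)) (inl (side e (~~ o))) *
    pcflux p (tau Lambda e) (inl (side e o)) (inl (side e (~~ o)))).
Proof.
rewrite /gflux /V /= (etaD_orient _ e o false) addn0 mulrDr; congr (_ + _).
by rewrite mulrCA.
Qed.

Lemma gflux_dual eps eta p a (e : edge m) o :
  gflux f (transmissibility Lambda) (fun e => @etaD R m Lambda e false false) eps eta p a e true o =
  rho_mean f p a (inr (ends e o)) (inr (ends e (~~ o))) * dual_V Lambda f eps p a e o +
  eta * (-1) ^+ deg a * (rho_mean f p a (inr (ends e o)) (inr (ends e (~~ o))) *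
    pcflux p (dual_tau Lambda e) (inr (ends e o)) (inr (ends e (~~ o)))).
Proof.
rewrite /gflux /dual_V /= (etaD_orient _ e false o) add0n mulrDr; congr (_ + _).
by rewrite mulrCA.
Qed.

Lemma scheme_network eps eta p a A : scheme phi Lambda f dt eps eta p pn a A =
  gscheme f pore_volume (transmissibility Lambda) (fun e => @etaD R m Lambda e false false)
    dt pn eps eta p a A.
Proof.
set c := eta * (-1) ^+ deg a; pose flux := gflux f (transmissibility Lambda)
  (fun e => @etaD R m Lambda e false false) eps eta p a.
have split_sum (B : node m) : \sum_e \sum_k \sum_(o | nd e k o == B) flux e k o =
    \sum_e \sum_(o | nd e true o == B) flux e true o +
    \sum_e \sum_(o | nd e false o == B) flux e false o.
  by rewrite -big_split; apply: eq_bigr => e _; rewrite big_bool.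
have eq_inl (x y : pnode m) : (inl x == inl y :> node m) = (x == y).
  by apply/eqP/eqP => [[->]|->].
have eq_inr (x y : vertex m) : (inr x == inr y :> node m) = (x == y).
  by apply/eqP/eqP => [[->]|->].
rewrite /gscheme split_sum /gacc; case: A => [[K|b]|v].
- rewrite [X in dt * (X + _)]big1 => [|e _]; last by rewrite big1 // => o /eqP.
  have -> : \sum_e \sum_(o | nd e false o == inl (inl K)) flux e false o =
    \sum_(e : edge m) \sum_(o : bool | side e o == inl K)
      rho_mean f p a (inl (side e o)) (inl (side e (~~ o))) * V Lambda f eps p a e o +
    c * \sum_(e : edge m) \sum_(o : bool | side e o == inl K)
      rho_mean f p a (inl (side e o)) (inl (side e (~~ o))) *
      pcflux p (tau Lambda e) (inl (side e o)) (inl (side e (~~ o))).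
    rewrite mulr_sumr -big_split; apply: eq_bigr => e _ /=.
    rewrite mulr_sumr -big_split /=; apply: eq_big => o; first exact: eq_inl.
    by move=> _; rewrite /flux gflux_primal.
  by rewrite /scheme /accumulation /pore_volume add0r /c; ring.
- rewrite [X in dt * (X + _)]big1 => [|e _]; last by rewrite big1 // => o /eqP.
  have -> : \sum_e \sum_(o | nd e false o == inl (inr b)) flux e false o = flux (inr b) false true.
    rewrite (bigD1 (inr b)) //= [X in _ + X]big1 ?addr0 => [|e eb]; last first.
      rewrite big1 // => o /eqP; case: e eb => [i|b'] eb; case: o => //= -[] bb.
      by move: eb; rewrite bb eqxx.
    by rewrite (big_pred1 true) => [|o]; last by case: o => //=; rewrite eqxx.
  rewrite /flux gflux_primal /= mul0r; ring.
- rewrite [X in dt * (_ + X)]big1 => [|e _]; last by rewrite big1 // => o /eqP.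
  have -> : \sum_e \sum_(o | nd e true o == inr v) flux e true o =
    \sum_(e : edge m) \sum_(o : bool | ends e o == v)
      rho_mean f p a (inr (ends e o)) (inr (ends e (~~ o))) * dual_V Lambda f eps p a e o +
    c * \sum_(e : edge m) \sum_(o : bool | ends e o == v)
      rho_mean f p a (inr (ends e o)) (inr (ends e (~~ o))) *
      pcflux p (dual_tau Lambda e) (inr (ends e o)) (inr (ends e (~~ o))).
    rewrite mulr_sumr -big_split; apply: eq_bigr => e _ /=.
    rewrite mulr_sumr -big_split /=; apply: eq_big => o; first exact: eq_inr.
    by move=> _; rewrite /flux gflux_dual.
  by rewrite /scheme /accumulation /pore_volume addr0 /c; ring.
Qed.

End SchemeNetwork.

Lemma pore_volume_ge0 (R : realType) (m : mesh R) (hm : is_mesh m) (phi : R * R -> R)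
  (hphi : is_porosity (domain m) phi) (A : node m) : 0 <= pore_volume phi A.
Proof.
rewrite /pore_volume; case: A => [[K|b]|v] //.
- by apply: (porosity_ge0 hm hphi); [exact: cell_open|exact: cell_sub].
- by apply: (porosity_ge0 hm hphi); [exact: dual_open|exact: dual_sub].
Qed.

Theorem mainTheorem2 (R : realType) (m : mesh R) (hm : is_mesh m)
  (f : fluid R) (hf : is_fluid f)
  (phi : R * R -> R) (hphi : is_porosity (domain m) phi)
  (Lambda : R * R -> 'M[R]_2) (hLambda : is_permeability (domain m) Lambda)
  (dt : R) (hdt : 0 < dt)
  (pn : phase -> node m -> R) (hpn : forall a, RTDir (pn a))
  (hsn : forall a A, 0 <= sat f pn a A <= 1) :
  (forall eps eta : R, 0 < eps -> 0 < eta ->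
     exists p : phase -> node m -> R,
       (forall a, RTDir (p a)) /\
       solves_scheme phi Lambda f dt eps eta p pn) /\
  (exists p : phase -> node m -> R,
     (forall a, RTDir (p a)) /\
     solves_scheme phi Lambda f dt 0 0 p pn).
Proof.
have vol := pore_volume_ge0 hm hphi; have T0 := transmissibility_gt0 hm hLambda.
have HT := etaD_lt hm hLambda; have conn := nodes_connected hm.
split=> [eps eta eps0 eta0|].
  have [p [pD ps]] := gsolves_eps hf vol T0 HT hdt hsn conn eps0 (ltW eta0).
  by exists p; split => // a A dA; rewrite scheme_network ps.
have [p [pD ps]] := gsolves_exists hf vol T0 HT hdt hsn conn.
by exists p; split => // a A dA; rewrite scheme_network ps.
Qed.
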